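(* Let $f,g:S^1\to\mathbb{R}^2$ be generic functions. If $H_0^{u,v}(s\circ f)=H_0^{u,v}(s\circ g)$ (equality understood up to isomorphism, i.e. equality of ranks) for every $(u,v)\in\Delta^+$ and every $s\in\Sigma_2$, then there exists a $C^1$-diffeomorphism $h:S^1\to S^1$ such that $g\circ h=f$.
   Context: Generic functions. A function $f:S^1\to\mathbb{R}^2$ is called generic if it is $C^1$ and: (C1) $f$ is an immersion, i.e. the differential $d_\theta f$ has rank one for every $\theta\in S^1$; (C2) $f(S^1)$ has at most a finite number of multiple points (points of $\mathbb{R}^2$ with more than one preimage under $f$), all of them are double points (exactly two preimages), and they are clean, i.e. for all $\theta_1,\theta_2\in S^1$, $f(\theta_1)=f(\theta_2)$ and $\mathrm{im}\,d_{\theta_1}f=\mathrm{im}\,d_{\theta_2}f$ (as linear subspaces of $\mathbb{R}^2$) imply $\theta_1=\theta_2$. Persistent homology. For $u=(u_1,u_2)\in\mathbb{R}^2$ let $D^u=\{(w_1,w_2)\in\mathbb{R}^2: w_1\le u_1 \text{ and } w_2\le u_2\}$. Let $\Delta^+=\{(u,v)\in\mathbb{R}^2\times\mathbb{R}^2: u_1<v_1 \text{ and } u_2<v_2\}$. For a continuous $f:S^1\to\mathbb{R}^2$ and $(u,v)\in\Delta^+$, the 0th bi-dimensional persistent homology group of $f$ at $(u,v)$ is $H_0^{u,v}(f)=\mathrm{im}\,H_0\bigl(f^{-1}(D^u)\hookrightarrow f^{-1}(D^v)\bigr)$, where the arrow is the inclusion and $H_0$ is Čech homology with real coefficients. Its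 rank is finite and equals the number of connected components of $f^{-1}(D^v)$ that contain at least one point of $f^{-1}(D^u)$. Two such groups are regarded as equal when they are isomorphic, equivalently when they have the same rank. Reflections. $s_1,s_2:\mathbb{R}^2\to\mathbb{R}^2$ are $s_1(x_1,x_2)=(-x_1,x_2)$ and $s_2(x_1,x_2)=(x_1,-x_2)$; $\Sigma_2=\{\mathrm{id},s_1,s_2,s_1\circ s_2\}$ is the set of maps obtained by finite composition of $s_1,s_2$. *)

(* Defs.v *)
From HB Require Import structures.
From mathcomp Require Import all_boot all_order all_algebra.
From mathcomp Require Import all_classical all_reals all_analysis.

Set Implicit Arguments.
Unset Strict Implicit.
Unset Printing Implicit Defensive.

Import Order.TTheory GRing.Theory Num.Theory.
Import numFieldNormedType.Exports.

Local Open Scope classical_set_scope.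
Local Open Scope ring_scope.

Section Circle.
Variable R : realType.

(* Used as a type through the coercion [set >-> Type]; as such it carries the
   topology induced by the plane. *)
Definition circle : set 'rV[R]_2 := [set p | p 0 0 ^+ 2 + p 0 1 ^+ 2 = 1].

Definition cos_sin (t : R) : 'rV[R]_2 :=
  \row_(i < 2) if i == 0 then cos t else sin t.

Lemma cos_sin_circle (t : R) : cos_sin t \in circle.
Proof. by rewrite inE /circle /= !mxE /= cos2Dsin2. Qed.

Definition angle (t : R) : circle := exist _ (cos_sin t) (cos_sin_circle t).

(* [angle] is a covering and restricts to smooth charts of the circle, so a map
   from the circle to the plane is C^1 iff its lift to the line is. *)
Definition circle_lift (f : circle -> 'rV[R]_2) : R -> 'rV[R]_2 := f \o angle.

Definition C1 (f : circle -> 'rV[R]_2) : Prop :=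
  (forall t, derivable (circle_lift f) t 1) /\
  continuous (derive1 (circle_lift f)).

(* The 1 x 2 matrix (in row vector convention) of the differential of [f] at
   the point [angle t], relative to the basis of the tangent line given by the
   velocity of [angle]; its row space is the image of the differential. *)
Definition differential (f : circle -> 'rV[R]_2) (t : R) : 'M[R]_(1, 2) :=
  derive1 (circle_lift f) t.

Definition immersion (f : circle -> 'rV[R]_2) : Prop :=
  forall t, \rank (differential f t) = 1%N.

Definition multiple_point (f : circle -> 'rV[R]_2) : set 'rV[R]_2 :=
  [set w | exists x y, [/\ x <> y, f x = w & f y = w]].

Definition double_point (f : circle -> 'rV[R]_2) : set 'rV[R]_2 :=
  [set w | exists x y, x <> y /\ f @^-1` [set w] = [set x; y]].

Definition clean (f : circle -> 'rV[R]_2) : Prop :=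
  forall t1 t2, f (angle t1) = f (angle t2) ->
    (differential f t1 == differential f t2)%MS -> angle t1 = angle t2.

Definition generic (f : circle -> 'rV[R]_2) : Prop :=
  [/\ C1 f,
      immersion f,
      finite_set (multiple_point f),
      multiple_point f `<=` double_point f
    & clean f].

(* A self-map of the circle is C^1 iff it is C^1 as a map to the plane, the
   circle being an embedded submanifold. *)
Definition C1_circle (h : circle -> circle) : Prop := C1 (fun x => \val (h x)).

Definition C1_diffeomorphism (h : circle -> circle) : Prop :=
  exists k : circle -> circle,
    [/\ cancel h k, cancel k h, C1_circle h & C1_circle k].

End Circle.
Arguments circle : clear implicits.

(* Cech homology in degree 0, with coefficients in R, of subspaces of a
   topological space, as the inverse limit over the finite open covers of the
   simplicial homology of their nerves. A cover is indexed by 'I_n; repeated and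
   empty members are allowed, but empty ones are not vertices of the nerve. *)
Section CechHomology.
Variables (R : realType) (T : topologicalType).
Implicit Types A B : set T.

Definition open_cover A n (U : 'I_n -> set T) : Prop :=
  (forall i, exists2 O, open O & U i = A `&` O) /\ \bigcup_i U i = A.

Definition nerve_chain0 n (U : 'I_n -> set T) (c : 'rV[R]_n) : Prop :=
  forall i, U i = set0 -> c 0 i = 0.

(* The row space is the image of the boundary map from 1-chains to 0-chains,
   i.e. the span of the boundaries of the edges of the nerve. *)
Definition nerve_boundary0 n (U : 'I_n -> set T) : 'M[R]_n :=
  (\sum_(e : 'I_n * 'I_n | `[< U e.1 `&` U e.2 !=set0 >])
     <<delta_mx 0 e.2 - delta_mx 0 e.1 : 'rV[R]_n>>)%MS.

Definition refinement m n (V : 'I_m -> set T) (U : 'I_n -> set T)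
    (p : 'I_m -> 'I_n) : Prop :=
  forall j, V j `<=` U (p j).

Definition push_chain m n (p : 'I_m -> 'I_n) (c : 'rV[R]_m) : 'rV[R]_n :=
  \row_i \sum_(j | p j == i) c 0 j.

(* Elements of the inverse limit are represented by choosing a 0-chain in each
   nerve. Only the values at open covers are meaningful, and only up to
   boundaries: see [cech_H0] and [cech_eq]. *)
Definition prethread : Type := forall n, ('I_n -> set T) -> 'rV[R]_n.

Definition cech_H0 A : set prethread := [set c |
  (forall n (U : 'I_n -> set T), open_cover A U -> nerve_chain0 U (c n U)) /\
  (forall m n (V : 'I_m -> set T) (U : 'I_n -> set T) (p : 'I_m -> 'I_n),
     open_cover A V -> open_cover A U -> refinement V U p ->
     (push_chain p (c m V) - c n U <= nerve_boundary0 U)%MS)].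

(* Equality of the classes represented by [c] and [d] in the H_0 of [A]. *)
Definition cech_eq A (c d : prethread) : Prop :=
  forall n (U : 'I_n -> set T), open_cover A U ->
    (c n U - d n U <= nerve_boundary0 U)%MS.

(* The map induced in H_0 by the inclusion of [A] in a larger subspace: the
   nerve of the trace on [A] of a cover [U] is a subcomplex of the nerve
   of [U]. *)
Definition cech_incl A (c : prethread) : prethread :=
  fun n U => c n (fun i => A `&` U i).

Definition lincomb k (a : 'I_k -> R) (c : 'I_k -> prethread) : prethread :=
  fun n U => \sum_i a i *: c i n U.

(* For [A `<=` B], the image of H_0 A -> H_0 B has dimension [k]: the images of
   the [c i] form a basis of it. *)
Definition rank_cech_incl A B (k : nat) : Prop :=
  exists c : 'I_k -> prethread,
    let b i := cech_incl A (c i) in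
    [/\ forall i, cech_H0 A (c i),
        forall a, cech_eq B (lincomb a b) (fun _ _ => 0) -> forall i, a i = 0
      & forall d, cech_H0 A d ->
          exists a, cech_eq B (cech_incl A d) (lincomb a b)].

End CechHomology.

Section Persistence.
Variable R : realType.

Definition lower_quadrant (u : 'rV[R]_2) : set 'rV[R]_2 :=
  [set w | w 0 0 <= u 0 0 /\ w 0 1 <= u 0 1].

Definition Delta_plus : set ('rV[R]_2 * 'rV[R]_2) :=
  [set uv : 'rV[R]_2 * 'rV[R]_2 |
     uv.1 0 0 < uv.2 0 0 /\ uv.1 0 1 < uv.2 0 1].

Definition persistent_H0_rank (f : circle R -> 'rV[R]_2) (u v : 'rV[R]_2)
    (k : nat) : Prop :=
  rank_cech_incl R (f @^-1` lower_quadrant u) (f @^-1` lower_quadrant v) k.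

(* The groups are real vector spaces of finite dimension, hence isomorphic iff
   they have the same rank. *)
Definition persistent_H0_isomorphic (f g : circle R -> 'rV[R]_2)
    (u v : 'rV[R]_2) : Prop :=
  forall k, persistent_H0_rank f u v k <-> persistent_H0_rank g u v k.

Definition reflection1 (x : 'rV[R]_2) : 'rV[R]_2 :=
  \row_(i < 2) if i == 0 then - x 0 0 else x 0 1.

Definition reflection2 (x : 'rV[R]_2) : 'rV[R]_2 :=
  \row_(i < 2) if i == 0 then x 0 0 else - x 0 1.

Definition Sigma2 : set ('rV[R]_2 -> 'rV[R]_2) :=
  [set s | [\/ s = id, s = reflection1, s = reflection2
             | s = reflection1 \o reflection2]].

End Persistence.

(* Main.v *)
Require Import Defs.
From mathcomp Require Import all_boot all_order all_algebra.
From mathcomp Require Import all_classical all_reals all_analysis.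
From mathcomp Require Import zify ring lra.

Set Implicit Arguments.
Unset Strict Implicit.
Unset Printing Implicit Defensive.

Import Order.TTheory GRing.Theory Num.Theory.
Import numFieldNormedType.Exports.

Local Open Scope classical_set_scope.
Local Open Scope ring_scope.

(** Two facts carry the proof.

    The persistent ranks determine the image of the curve. As [v] decreases to
    [u], the rank at [(u, v)] becomes the number of connected components of the
    preimage of the quadrant at [u] ([rank_sublevel], which rests on the
    computation of Cech homology in [rank_cech_incl_pieces] and on the cutting
    of the circle in [rank_arcs]). When the coordinates of [u] are regular
    values of the coordinate functions, which by Sard is the case for almost all
    of them ([exists_regular]), this number is finite and, unless the whole
    curve lies in the quadrant, it is the number of points where the curve
    leaves the quadrant, which it does with nonzero speed across the boundary.
    The quadrant below and to the left of [(x, y)] and its mirror image in the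
    horizontal line of height [y] make up a half plane. Comparing the exit
    points of the three regions, those on the vertical line cancel, and what is
    left is the number of points of the curve on the horizontal ray from [(x,
    y)] to the left ([same_count_ray]). So the ranks determine this number, and
    its jumps in [x] are the points of the curve at height [y]. At each point of
    an immersed curve one of the coordinates has nonzero derivative and hence
    takes regular values at nearby points. So the points that can be recovered
    in this way, or with the coordinates exchanged, are dense, and as images of
    curves are compact, the two images coincide ([planar_image_sub]).

    Two clean immersed curves with the same image differ by a diffeomorphism. A
    point of the first curve is the limit of other points of that curve, which
    also lie on the second curve; in the limit this gives a point of the second
    curve with the same position and the same tangent line ([tangent_exists]).
    By cleanness there is only one such point, which defines the map [h], and
    the roles of the curves can be exchanged, so [h] is bijective. Its graph is
    closed, since positions and tangents are continuous, so [h] is continuous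
    ([matching_continuous]); inverting locally a coordinate of the second curve
    with nonzero derivative shows that it is of class [C^1] ([matching_C1]). *)

(** * Cech homology in degree zero *)

Section CechRank.
Variables (R : realType) (T : topologicalType).
Implicit Types (A B : set T) (c d : prethread R T).

Lemma push_chain_delta m n (p : 'I_m -> 'I_n) (j : 'I_m) :
  push_chain p (delta_mx 0 j : 'rV[R]_m) = delta_mx 0 (p j).
Proof.
apply/rowP => i; rewrite !mxE eqxx /= big_mkcond (bigD1 j) //= big1.
  by rewrite !mxE !eqxx addr0 [in RHS]eq_sym; case: eqP.
by move=> k kj; rewrite mxE (negbTE kj) andbF; case: ifP.
Qed.

Lemma push_chainE m n (p : 'I_m -> 'I_n) (c : 'rV[R]_m) :
  push_chain p c = \sum_j c 0 j *: delta_mx 0 (p j).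
Proof.
apply/rowP => i; rewrite !mxE summxE big_mkcond; apply: eq_bigr => j _.
by rewrite !mxE eqxx /= [i == _]eq_sym; case: eqP => _; rewrite ?mulr1 ?mulr0.
Qed.

Lemma nerve_boundary0_edge n (U : 'I_n -> set T) i j :
  U i `&` U j !=set0 ->
  ((delta_mx 0 j - delta_mx 0 i : 'rV[R]_n) <= nerve_boundary0 R U)%MS.
Proof.
move=> Uij; rewrite /nerve_boundary0; apply: (sumsmx_sup (i, j)) => /=.
  exact/asboolP.
by rewrite genmxE.
Qed.

Lemma nerve_boundary0_min n (U : 'I_n -> set T) m (M : 'M[R]_(m, n)) :
  (forall i j, U i `&` U j !=set0 ->
    ((delta_mx 0 j - delta_mx 0 i : 'rV[R]_n) <= M)%MS) ->
  (nerve_boundary0 R U <= M)%MS.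
Proof.
move=> H; apply/sumsmx_subP => -[i j] /asboolP /= Uij.
by rewrite genmxE; exact: H.
Qed.

(** A cover by disjoint sets has a nerve without proper edges, so chains can be
    compared there coefficient by coefficient. *)
Lemma nerve_boundary0_disjoint n (U : 'I_n -> set T) (x : 'rV[R]_n) :
  (forall i j, U i `&` U j !=set0 -> i = j) ->
  (x <= nerve_boundary0 R U)%MS -> x = 0.
Proof.
move=> dU xU; apply/eqP; rewrite -submx0 (submx_trans xU) //.
by apply: nerve_boundary0_min => i j /dU ->; rewrite subrr sub0mx.
Qed.

Lemma cech_eq_incl A B c d :
  A `<=` B -> cech_eq A c d -> cech_eq B (cech_incl A c) (cech_incl A d).
Proof.
move=> AB cd n U [Uo UB]; apply: submx_trans (cd n _ _) _.
  split.
    move=> i; have [Z oO UO] := Uo i; exists Z => //.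
    by rewrite UO setIA (setIidl AB).
  by rewrite -setI_bigcupr UB; exact: setIidl.
apply: nerve_boundary0_min => i j [x [[_ xi] [_ xj]]].
by apply: nerve_boundary0_edge; exists x.
Qed.

Lemma cech_eq_sym A c d : cech_eq A c d -> cech_eq A d c.
Proof.
by move=> cd n U oU; rewrite -opprB eqmx_opp; exact: cd.
Qed.

Lemma cech_eq_trans A c d e : cech_eq A c d -> cech_eq A d e -> cech_eq A c e.
Proof.
move=> cd de n U oU.
by rewrite -(subrK (d n U) (c n U)) -addrA addmx_sub ?cd ?de.
Qed.

Lemma cech_eq_lincomb A k (a : 'I_k -> R) (c d : 'I_k -> prethread R T) :
  (forall i, cech_eq A (c i) (d i)) -> cech_eq A (lincomb a c) (lincomb a d).
Proof.
move=> cd n U oU; rewrite /lincomb -sumrB summx_sub // => i _.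
by rewrite -scalerBr scalemx_sub ?cd.
Qed.

(** The matrices that express two bases of one space in terms of each other
    have the identity as product, so neither basis is larger than the other. *)
Lemma rank_cech_incl_leq A B k l :
  rank_cech_incl R A B k -> rank_cech_incl R A B l -> (l <= k)%N.
Proof.
move=> [c [cA _ cgen]] [d [dA dfree dgen]].
have /choice[M HM] := fun j => cgen _ (dA j).
have /choice[M' HM'] := fun j => dgen _ (cA j).
set P : 'M[R]_(l, k) := \matrix_(j, i) M j i.
set Q : 'M[R]_(k, l) := \matrix_(i, j) M' i j.
suff PQ : P *m Q = 1%:M.
  by rewrite -(@mxrank1 R l) -PQ (leq_trans (mxrankM_maxl _ _)) ?rank_leq_col.
apply/matrixP => j j'; apply/eqP; rewrite -subr_eq0; apply/eqP.
pose a j' := (P *m Q) j j' - (1%:M : 'M[R]_l) j j'.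
apply: (dfree a _ j').
have E1 : cech_eq B (cech_incl A (d j))
    (lincomb (fun j' => (P *m Q) j j') (fun i => cech_incl A (d i))).
  apply: cech_eq_trans (HM j) _; apply: cech_eq_trans.
    by apply: cech_eq_lincomb => i; exact: HM'.
  move=> n U _; rewrite /lincomb.
  under eq_bigr do rewrite scaler_sumr.
  rewrite exchange_big -sumrB summx_sub //= => i _.
  rewrite mxE scaler_suml -sumrB summx_sub // => i' _.
  by rewrite !mxE scalerA subrr sub0mx.
move=> n U oU; have := cech_eq_sym E1 oU; rewrite subr0 /lincomb.
congr (_ <= _)%MS; rewrite /a.
under [in RHS]eq_bigr do rewrite scalerBl.
rewrite sumrB; congr (_ - _); rewrite (bigD1 j) //= big1 ?addr0.
  by rewrite mxE eqxx scale1r.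
by move=> i ij; rewrite mxE eq_sym (negbTE ij) scale0r.
Qed.

Lemma rank_cech_incl_uniq A B k l :
  rank_cech_incl R A B k -> rank_cech_incl R A B l -> k = l.
Proof.
by move=> Hk Hl; apply/eqP; rewrite eqn_leq !(@rank_cech_incl_leq A B).
Qed.

(** The class of a point: in each nerve, a vertex whose open set contains it. *)
Definition point_thread (x : T) : prethread R T := fun n U =>
  if [pick j : 'I_n | `[< U j x >]] is Some j then delta_mx 0 j else 0.

Lemma point_threadE A n (U : 'I_n -> set T) x : open_cover A U -> A x ->
  exists2 j, U j x & point_thread x U = delta_mx 0 j.
Proof.
move=> [_ UA]; rewrite -UA => -[j _ Ujx]; rewrite /point_thread.
case: pickP => [i /asboolP Uix|/(_ j)/asboolP//]; by exists i.
Qed.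

Lemma cech_H0_point A x : A x -> cech_H0 A (point_thread x).
Proof.
move=> Ax; split=> [n U oU i U0|m n V U p oV oU VU].
  have [j Ujx ->] := point_threadE oU Ax; rewrite mxE eqxx /=.
  by case: eqP => // ij; rewrite -ij U0 in Ujx.
have [j Vjx ->] := point_threadE oV Ax.
have [j' Ujx ->] := point_threadE oU Ax.
rewrite push_chain_delta; apply: nerve_boundary0_edge; exists x; split=> //.
exact: VU.
Qed.

(** The nerve of a cover is connected along a connected set: otherwise the
    members in one component of the nerve would cut out a clopen part. *)
Lemma connected_nerve A n (U : 'I_n -> set T) C j j' :
  open_cover A U -> C `<=` A -> connected C ->
  C `&` U j !=set0 -> C `&` U j' !=set0 ->
  ((delta_mx 0 j' - delta_mx 0 j : 'rV[R]_n) <= nerve_boundary0 R U)%MS.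
Proof.
move=> [Uo UA] CA cC Cj [x [Cx xj']].
have /choice[Z HO] : forall i, exists Z, open Z /\ U i = A `&` Z.
  by move=> i; have [Z] := Uo i; exists Z.
pose D i := ((delta_mx 0 i - delta_mx 0 j : 'rV[R]_n) <= nerve_boundary0 R
  U)%MS.
have DU i i' : U i `&` U i' !=set0 -> D i -> D i'.
  move=> Uii' Di; rewrite /D -(subrK (delta_mx 0 i) (delta_mx 0 i')) -addrA.
  exact: addmx_sub (nerve_boundary0_edge Uii') Di.
pose S := C `&` \bigcup_(i in [set i | D i]) Z i.
have UO i y : C y -> U i y <-> Z i y.
  by move=> Cy; rewrite (HO i).2; split=> [[]//|Oy]; split=> //; exact: CA.
suff SC : S = C.
  move: (Cx); rewrite -SC => -[_ [i Di Oi]]; apply: (DU i) => //.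
  by exists x; split=> //; apply/UO.
apply: cC.
- have [y [Cy Ujy]] := Cj; exists y; split=> //; exists j; last exact/UO.
  by rewrite /= /D subrr sub0mx.
- exists (\bigcup_(i in [set i | D i]) Z i) => //.
  by apply: bigcup_open => i _; exact: (HO i).1.
- exists (~` \bigcup_(i in [set i | ~~ D i]) Z i).
    by rewrite closedC; apply: bigcup_open => i _; exact: (HO i).1.
  apply/seteqP; split=> y [Cy].
    move=> [i /= Di Oi]; split=> // -[i' /= /negP Di' Oi']; apply: Di'.
    by apply: (DU i) => //; exists y; split; apply/UO.
  have [i _ Ui] : (\bigcup_i U i) y by rewrite UA; exact: CA.
  move=> nD; split=> //; exists i; last exact/UO.
  by apply: contrapT => /negP Di; apply: nD; exists i => //; apply/UO.
Qed.

(** When [A] falls into finitely many connected pieces lying in disjoint open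
    sets [W i], the classes of one point in each piece form a basis: they span
    because every cover can be refined by its traces on the pieces, and the
    cover of [B] by the [W i] shows that they stay independent in [B]. *)
Lemma rank_cech_incl_pieces A B N (C W : 'I_N -> set T) :
  (forall i, connected (C i)) -> (forall i, C i !=set0) ->
  (forall i, C i `<=` W i) -> (forall i, open (W i)) ->
  (forall i j, W i `&` W j !=set0 -> i = j) ->
  \bigcup_i C i = A -> A `<=` B -> ('I_N -> B `<=` \bigcup_i W i) ->
  rank_cech_incl R A B N.
Proof.
move=> cC /choice[x Cx] CW oW dW CA AB BW.
have CsubA i : C i `<=` A by rewrite -CA; exact: bigcup_sup.
have oCA : open_cover A C.
  split=> // i; exists (W i) => //; apply/seteqP; split=> y Cy.
    by split; [exact: CsubA Cy|exact: CW].
  case: Cy; rewrite -CA => -[j _ Cj] Wi.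
  by have <- // : j = i; apply: dW; exists y; split=> //; exact: CW.
exists (fun i => point_thread (x i)) => b; split.
- by move=> i; apply: cech_H0_point; exact: CsubA.
- move=> a aeq i.
  (* On the cover of [B] by the [W i], the chain of a point of [C i] is the
     vertex [i], and there are no boundaries to divide by. *)
  have oWB : open_cover B (fun i => B `&` W i).
    split=> [j|]; first by exists (W j).
    by rewrite -setI_bigcupr; apply/setIidl/BW.
  have oWA : open_cover A (fun i => A `&` (B `&` W i)).
    split=> [j|]; first by exists (W j) => //; rewrite setIA (setIidl AB).
    by rewrite -setI_bigcupr oWB.2; apply/setIidl.
  have dWB j j' : B `&` W j `&` (B `&` W j') !=set0 -> j = j'.
    by move=> [y [[_ ?] [_ ?]]]; apply: dW; exists y.
  have := aeq _ _ oWB; rewrite subr0.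
  move=> /(nerve_boundary0_disjoint dWB)/rowP/(_ i); rewrite [RHS]mxE => <-.
  rewrite /lincomb summxE (bigD1 i) //= big1 ?addr0.
    have [j [_ [_ Wj]]] := point_threadE oWA (CsubA _ _ (Cx i)).
    rewrite /b /cech_incl => ->.
    have -> : j = i by apply: dW; exists (x i); split=> //; exact: CW.
    by rewrite !mxE !eqxx mulr1.
  move=> k ki; have [j [_ [_ Wj]]] := point_threadE oWA (CsubA _ _ (Cx k)).
  rewrite /b /cech_incl => ->.
  have -> : j = k by apply: dW; exists (x k); split=> //; exact: CW.
  by rewrite !mxE eq_sym (negbTE ki) andbF mulr0.
- (* The coordinates are read off at the cover of [A] by its pieces. *)
  move=> d [d0 dr]; exists (fun i => d N C 0 i).
  pose e := lincomb (fun i => d N C 0 i) (fun i => point_thread (x i)).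
  suff : cech_eq A d e by exact: cech_eq_incl.
  move=> n U oU.
  (* [V] refines both the pieces and the given cover; pushed to [U], its
     vertices can be moved to the vertex of the chosen point of their piece. *)
  pose V (k : 'I_#|{: 'I_N * 'I_n}|) := C (enum_val k).1 `&` U (enum_val k).2.
  have oV : open_cover A V.
    split=> [k|].
      have [Z oO CO] := oCA.1 (enum_val k).1.
      have [Z' oO' UO] := oU.1 (enum_val k).2.
      exists (Z `&` Z'); first exact: openI.
      by rewrite /V CO UO setIACA setIid.
    apply/seteqP; split=> [y [k _ [Cy _]]|y Ay]; first exact: CsubA Cy.
    have := Ay; rewrite -CA => -[i _ Ciy].
    have := Ay; rewrite -oU.2 => -[j _ Ujy].
    by exists (enum_rank (i, j)) => //; rewrite /V enum_rankK.
  pose p (k : 'I_#|{: 'I_N * 'I_n}|) := (enum_val k).1.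
  pose q (k : 'I_#|{: 'I_N * 'I_n}|) := (enum_val k).2.
  have EC : push_chain p (d _ V) = d N C.
    apply/eqP; rewrite -subr_eq0; apply/eqP.
    apply: (@nerve_boundary0_disjoint _ C).
      by move=> i j [y [? ?]]; apply: dW; exists y; split; exact: CW.
    by apply: dr => // k y [].
  have EU := dr _ _ _ _ q oV oU (fun k y => @proj2 _ _).
  rewrite -(subrK (push_chain q (d _ V)) (d n U)) -addrA addmx_sub //.
    by rewrite -opprB eqmx_opp.
  rewrite /e -EC push_chainE /lincomb.
  under [X in _ - X]eq_bigr do rewrite mxE scaler_suml big_mkcond /=.
  rewrite exchange_big -sumrB summx_sub //= => k _.
  rewrite -big_mkcond /= (eq_bigl (fun i => i == p k)); last first.
    by move=> i; rewrite eq_sym.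
  rewrite big_pred1_eq -scalerBr.
  have [Vk|/set0P[y [Cky Uky]]] := eqVneq (V k) set0.
    by rewrite (d0 _ _ oV _ Vk) scale0r sub0mx.
  rewrite scalemx_sub //.
  have [j Uj ->] := point_threadE oU (CsubA _ _ (Cx (p k))).
  apply: (connected_nerve oU (@CsubA (p k))) => //; first by exists (x (p k)).
  by exists y.
Qed.

(** The class of a point is nonzero: the cover by a single set sees it. *)
Lemma rank_cech_incl_eq0 A B :
  A `<=` B -> rank_cech_incl R A B 0 -> A = set0.
Proof.
move=> AB [c [_ _ gen]]; apply/seteqP; split=> // x Ax.
have [a] := gen _ (cech_H0_point Ax).
have oB : open_cover B (fun _ : 'I_1 => B).
  split=> [_|]; first by exists setT; rewrite ?setIT //; exact: openT.
  by apply/seteqP; split=> [y []//|y By]; exists ord0.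
have oA : open_cover A (fun _ : 'I_1 => A `&` B).
  split=> [_|]; first by exists setT; rewrite ?setIT ?(setIidl AB) //;
    exact: openT.
  by apply/seteqP; split=> [y [_ _ []]//|y Ay]; exists ord0 => //; split=> //;
    exact: AB.
move=> /(_ _ _ oB); rewrite /lincomb big_ord0 subr0.
move=> /(nerve_boundary0_disjoint (fun i j _ => etrans (ord1 i) (esym (ord1
  j)))).
have [j _ E] := point_threadE oA Ax; rewrite /cech_incl E.
by move=> /rowP/(_ j)/eqP; rewrite !mxE !eqxx oner_eq0.
Qed.

End CechRank.

(** * The circle as a quotient of the line *)

Section CircleCharts.
Variable R : realType.

Definition two_pi : R := pi *+ 2.

Lemma two_pi_gt0 : 0 < two_pi.
Proof. by rewrite mulrn_wgt0 ?pi_gt0. Qed.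

Lemma row2P (u v : 'rV[R]_2) : u 0 0 = v 0 0 -> u 0 1 = v 0 1 -> u = v.
Proof.
move=> e0 e1; apply/rowP => -[[|[|//]] i2].
  by rewrite (_ : Ordinal i2 = 0) //; exact: val_inj.
by rewrite (_ : Ordinal i2 = 1) //; exact: val_inj.
Qed.

Lemma cos_sinE : @cos_sin R =
  fun t => cos t *: delta_mx 0 0 + sin t *: delta_mx 0 1.
Proof.
by apply/funext => t; apply/row2P; rewrite !mxE /=;
  rewrite ?mulr0 ?mulr1 ?addr0 ?add0r.
Qed.

Lemma continuous_cos_sin : continuous (@cos_sin R).
Proof.
rewrite cos_sinE => t; apply: cvgD; apply: cvgZr_tmp.
  exact: continuous_cos.
exact: continuous_sin.
Qed.

Lemma continuous_angle : continuous (@angle R).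
Proof. exact/continuous_comp_initial/continuous_cos_sin. Qed.

Lemma continuous_circle_val : continuous (fun p : circle R => \val p).
Proof. exact: initial_continuous. Qed.

Lemma angleD2pi (t : R) : angle (t + two_pi) = angle t.
Proof. by apply/val_inj/rowP => i; rewrite !mxE sinD2pi cosD2pi. Qed.

Lemma angleD2pin (t : R) n : angle (t + two_pi *+ n) = angle t.
Proof.
elim: n => [|n IH]; first by rewrite mulr0n addr0.
by rewrite mulrSr addrA angleD2pi.
Qed.

Lemma angle_shift (t s : R) : exists2 t', s <= t' < s + two_pi & angle t' =
  angle t.
Proof.
pose n := Num.floor ((t - s) / two_pi).
have /andP[n0 n1] : n%:~R <= (t - s) / two_pi < (n + 1)%:~R.
  exact: real_floor_itv (num_real _).
rewrite ler_pdivlMr ?two_pi_gt0 // ltr_pdivrMr ?two_pi_gt0 // in n0 n1.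
exists (t - n%:~R * two_pi).
  move: n0 n1; rewrite intrD mulrDl mul1r => *.
  by apply/andP; split; lra.
case: n {n0 n1} => n; first by rewrite -[LHS](angleD2pin _ n) mulr_natl subrK.
by rewrite NegzE mulrNz mulNr opprK mulr_natl angleD2pin.
Qed.

Lemma angle_eqP (s t : R) : angle s = angle t -> `|s - t| < two_pi -> s = t.
Proof.
wlog ts : s t / t <= s.
  move=> H e l; have [/H ->//|/ltW/H->//] := leP t s.
  by rewrite distrC.
move=> /(congr1 val)/= /rowP e.
have := e 0; have := e 1; rewrite !mxE /= => es ec.
rewrite ger0_norm ?subr_ge0 // => l.
pose x := (s - t) / 2.
have x2 : s - t = x *+ 2 by rewrite /x mulr2n -splitr.
have : cos (s - t) = 1 by rewrite cosB es ec -!expr2 cos2Dsin2.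
rewrite x2 cos_mulr2n cos2sin2 => c1.
have s0 : sin x = 0.
  by apply/eqP; rewrite -sqrf_eq0; apply/eqP; move: c1; rewrite mulr2n; lra.
have : ~ 0 < x.
  move=> x0; suff : 0 < sin x by rewrite s0 ltxx.
  apply: sin_gt0_pi; rewrite x0 /=.
  by move: l; rewrite x2 /two_pi ltrMn2r.
move/negP; rewrite -leNgt /x => ?; lra.
Qed.

Lemma angle_lift (s : R) (p : circle R) :
  exists2 t, s <= t < s + two_pi & angle t = p.
Proof.
have [t <-] : exists t, angle t = p.
  have pP : \val p 0 0 ^+ 2 + \val p 0 1 ^+ 2 = 1 by have := set_valP p.
  pose x : R := \val p 0 0; pose y : R := \val p 0 1.
  have {}pP : x ^+ 2 + y ^+ 2 = 1 by [].
  have x1 : -1 <= x <= 1 by apply/andP; split; nra.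
  have sx : Num.sqrt (1 - x ^+ 2) = `|y| by rewrite -pP addrAC subrr add0r
    sqrtr_sqr.
  exists (if 0 <= y then acos x else - acos x); apply/val_inj/row2P.
    by rewrite !mxE /=; case: ifP; rewrite ?cosN acosK // in_itv.
  rewrite !mxE /=; have [y0|y0] := leP 0 y.
    by rewrite sin_acos // sx ger0_norm.
  by rewrite sinN sin_acos // sx ltr0_norm // opprK.
exact: angle_shift.
Qed.

Lemma compact_circle : compact [set: circle R].
Proof.
rewrite (_ : setT = @angle R @` `[0, two_pi]).
  apply: continuous_compact; last exact: segment_compact.
  exact/continuous_subspaceT/continuous_angle.
apply/seteqP; split=> // p _; have [t /andP[t0 t1] <-] := angle_lift 0 p.
by exists t => //=; rewrite in_itv /= t0 -[two_pi]add0r ltW.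
Qed.

(** Closedness is tested in the plane, where compact sets are closed. *)
Lemma closed_angle_compact (A : set R) : compact A -> closed (@angle R @` A).
Proof.
move=> cA.
have -> : @angle R @` A = set_val @^-1` (@cos_sin R @` A).
  apply/seteqP; split=> p [t tab]; first by move=> <-; exists t.
  by move=> e; exists t => //; exact: val_inj.
apply: preimage_closed => [p _|]; first exact: continuous_circle_val.
apply: compact_closed; first exact: norm_hausdorff.
apply: continuous_compact => //.
exact/continuous_subspaceT/continuous_cos_sin.
Qed.

(** The complement is the image of the closed interval from [b] once around
    to [a]. *)
Lemma open_angle_itv (a b : R) : b <= a + two_pi -> open (@angle R @` `]a, b[).
Proof.
move=> ba; rewrite -[X in open X]setCK openC.
have -> : ~` (@angle R @` `]a, b[) = @angle R @` `[b, a + two_pi].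
  apply/seteqP; split=> p.
    move=> H; have [t /andP[t0 t1] tp] := angle_lift a p.
    have [ta|ta] := eqVneq t a.
      by exists (a + two_pi); rewrite ?angleD2pi -?ta //= in_itv /= lexx andbT
        ta.
    exists t => //=; rewrite in_itv /= (ltW t1) andbT.
    rewrite leNgt; apply/negP => tb; apply: H; exists t => //=.
    by rewrite in_itv /= tb andbT lt_neqAle eq_sym ta.
  move=> [t /=]; rewrite in_itv /= => /andP[bt ta] <- -[s /=].
  rewrite in_itv /= => /andP[sa sb] /angle_eqP st.
  have := st _; rewrite ltr_norml => H.
  have : s = t by apply: H; apply/andP; split; lra.
  lra.
exact/closed_angle_compact/segment_compact.
Qed.
Lemma connected_circle : connected [set: circle R].
Proof.
rewrite (_ : setT = @angle R @` setT); last first.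
  by apply/seteqP; split=> // p _; have [t _ <-] := angle_lift 0 p; exists t.
apply: connected_continuous_connected; last first.
  exact/continuous_subspaceT/continuous_angle.
by apply/connected_intervalP => x y _ _ z _.
Qed.

(** Any closed set of angles can be cut down to a compact one without changing
    its image, so the circle carries the quotient topology of the line. *)
Lemma continuous_circle (T : topologicalType) (h : circle R -> T) :
  continuous (h \o @angle R) -> continuous h.
Proof.
move=> ch; apply/continuous_closedP => C Cc.
rewrite (_ : h @^-1` C = @angle R @` ((h \o @angle R) @^-1` C `&` `[0,
  two_pi])).
  apply: closed_angle_compact; rewrite setIC.
  apply: compact_closedI; first exact: segment_compact.
  by move/continuous_closedP : ch; apply.
apply/seteqP; split=> [p Cp|p [t [Ct _] <-]//].
have [t /andP[t0 t1] tp] := angle_lift 0 p; exists t => //; split.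
  by rewrite /= tp.
by rewrite /= in_itv /= t0 -[two_pi]add0r ltW.
Qed.

End CircleCharts.

(** * Components of closed subsets of the circle *)

(** In this section [K] is a closed set such that, moving in the positive
    direction from a point of [K], one either stays in [K] for a while or leaves
    it at once, the latter exactly at the points of [out]. *)
Section Arcs.
Variables (R : realType) (K out : set (circle R)).
Hypothesis Kclosed : closed K.
Hypothesis stay : forall t, K (angle t) -> ~ out (angle t) ->
  \forall s \near t^'+, K (angle s).
Hypothesis outK : out `<=` K.
Hypothesis leave : forall t, out (angle t) ->
  \forall s \near t^'+, ~ K (angle s).

(** The exit point is the supremum of the parameters up to which [K] has not
    been left. *)
Lemma exit_exists (t t1 : R) : t <= t1 -> K (angle t) -> ~ K (angle t1) ->
  exists r, [/\ t <= r, r < t1, out (angle r) &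
             forall s, t <= s <= r -> K (angle s)].
Proof.
move=> tt1 Kt Kt1.
pose S := [set s | t <= s <= t1 /\ forall x, t <= x <= s -> K (angle x)].
have St : S t.
  by split=> [|x]; rewrite ?lexx // -eq_le => /eqP <-.
have ubS : ubound S t1 by move=> s [/andP[]].
have supS : has_sup S by split; [exists t|exists t1].
pose r := sup S.
have ubr : ubound S r by exact: sup_upper_bound.
have tr : t <= r by exact: ubr.
have rt1 : r <= t1 by apply: ge_sup => //; exists t.
have oKC : open (@angle R @^-1` ~` K).
  by move/continuousP : (@continuous_angle R); apply; rewrite openC.
have below x : t <= x < r -> K (angle x).
  move=> /andP[tx xr].
  have [s [sS Ss] xs] := sup_adherent (eps := r - x) ltac:(by rewrite subr_gt0)
    supS.
  by apply: Ss; rewrite tx /= ltW // (le_lt_trans _ xs) // subKr.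
have Kr : K (angle r).
  apply: contrapT => nKr.
  have : nbhs r (@angle R @^-1` ~` K) by exact: open_nbhs_nbhs.
  move=> /nbhs_ballP[e /= e0 Hb].
  have [s [sS Ss] es] := sup_adherent e0 supS.
  have sr : s <= r by apply: ubr; split.
  have : ~ K (angle s).
    apply: (Hb s); rewrite /ball /= ger0_norm ?subr_ge0 //.
    by rewrite ltrBlDr -ltrBlDl.
  by apply; apply: Ss; case/andP: sS => -> _ /=.
have Kle x : t <= x <= r -> K (angle x).
  move=> /andP[tx]; rewrite le_eqVlt => /predU1P[->//|xr].
  by apply: below; rewrite tx.
have r_t1 : r < t1.
  by rewrite lt_neqAle rt1 andbT; apply/eqP => E; apply: Kt1; rewrite -E.
exists r; split=> //; apply: contrapT => /(stay Kr) /nbhs_ballP[e /= e0 He].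
pose d := Num.min (e / 2) (t1 - r).
have d0 : 0 < d by rewrite lt_min divr_gt0 //= subr_gt0.
have de : d < e by rewrite gt_min ltr_pdivrMr // ltr_pMr // ltr1n.
have dt1 : r + d <= t1 by rewrite -lerBrDl ge_min lexx orbT.
suff : S (r + d) by move/ubr; rewrite gerDl leNgt d0.
split=> [|x /andP[tx xe]];
  first by rewrite dt1 andbT (le_trans tr) // lerDl ltW.
have [xr|rx] := leP x r; first by apply: Kle; rewrite tx.
apply: (He x) => //; rewrite /ball /= distrC ger0_norm ?subr_ge0 ?ltW //.
by rewrite ltrBlDl (le_lt_trans xe) // ltrD2l.
Qed.

(** Cut the circle at a point outside [K] and once between any two consecutive
    exit points: between consecutive cuts, [K] is an interval that ends at the
    only exit point there. *)
Lemma rank_arcs (rs : seq (circle R)) :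
  uniq rs -> (forall p, p \in rs <-> out p) -> K <> setT ->
  exists ms : seq (circle R), (forall p, p \in ms -> ~ K p) /\
    forall B, K `<=` B -> (forall p, p \in ms -> ~ B p) ->
      rank_cech_incl R K B (size rs).
Proof.
move=> urs rsP KT.
have [p0 Kp0] : exists p, ~ K p.
  by apply/existsNP => H; apply: KT; apply/seteqP; split.
have [t0 _ t0p] := angle_lift 0 p0; have Kt0 : ~ K (angle t0) by rewrite t0p.
have /choice[L LP] : forall p, exists t, t0 <= t < t0 + two_pi R /\ angle t = p.
  by move=> p; have [t] := angle_lift t0 p; exists t.
pose rl := sort <=%R (map L rs); pose N := size rs; pose r i := nth 0 rl i.
have srl : size rl = N by rewrite size_sort size_map.
have Linj : injective L by move=> p q /(congr1 (@angle R)); rewrite !(LP _).2.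
have rlP t : t0 <= t < t0 + two_pi R -> out (angle t) -> t \in rl.
  move=> t01 /rsP ot; rewrite mem_sort;
    suff -> : t = L (angle t) by exact: map_f.
  have [/andP[l0 l1] e] := LP (angle t).
  have := angle_eqP e; rewrite ltr_norml => H.
  by apply/esym/H; case/andP: t01 => *; apply/andP; split; lra.
have rlo i : (i < N)%N -> [/\ t0 < r i, r i < t0 + two_pi R & out (angle (r
  i))].
  rewrite -srl => /(mem_nth 0); rewrite mem_sort => /mapP[p prs E].
  rewrite /r E; have [/andP[l0 l1] e] := LP p; split=> //; last by rewrite e;
    exact/rsP.
  rewrite lt_neqAle l0 andbT; apply/eqP => E'; apply: Kt0; rewrite E' e.
  exact/outK/rsP.
have rlt i j : (i < j)%N -> (j < N)%N -> r i < r j.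
  move=> ij jN; rewrite /r (lt_sorted_ltn_nth 0) ?inE ?srl // ?(ltn_trans ij)
    //.
  by rewrite sort_lt_sorted map_inj_uniq.
(* A point [m i] outside [K] between the exit points [r i] and [r i.+1]. *)
have /choice[m mP] : forall i, exists m, (i < N)%N ->
    [/\ r i < m, (i.+1 < N)%N -> m < r i.+1 & ~ K (angle m)].
  move=> i; have [iN|] := ltnP i N; last by exists 0.
  have [_ _ oi] := rlo _ iN; have lv := leave oi.
  suff [x [? ? ?]] : exists x, [/\ r i < x, (i.+1 < N)%N -> x < r i.+1
      & ~ K (angle x)] by exists x.
  have [iN'|Ni] := boolP (i.+1 < N)%N.
    have ii := rlt _ _ (ltnSn i) iN'.
    near (r i)^'+ => x; exists x; split=> [|_|].
    - by near: x; exact: nbhs_right_gt.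
    - by near: x; exact: nbhs_right_lt.
    - by near: x; exact: lv.
  near (r i)^'+ => x; exists x; split=> //; near: x; exact: lv.
(* The cuts: the base point, then one after each exit point except the last,
   and the base point again after a full turn. *)
pose M j := if j is i.+1 then if (i.+1 < N)%N then m i else t0 + two_pi R else
  t0.
have Mr i : (i < N)%N -> M i < r i.
  case: i => [|i] iN; first by have [] := rlo _ iN.
  by rewrite /M iN; have [_ -> //] := mP i (ltnW iN).
have rM i : (i < N)%N -> r i < M i.+1.
  by move=> iN /=; case: ifP => _; [have [] := mP i iN|have [] := rlo _ iN].
have KM i : ~ K (angle (M i)).
  case: i => [//|i] /=; case: ifP => [iN|_]; last by rewrite angleD2pi.
  by have [] := mP i (ltnW iN).
have Mle i j : (i <= j)%N -> (j <= N)%N -> M i <= M j.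
  elim: j => [|j IH]; first by rewrite leqn0 => /eqP ->.
  rewrite leq_eqVlt => /predU1P[->//|]; rewrite ltnS => ij jN.
  by rewrite (le_trans (IH ij (ltnW jN))) // ltW // (lt_trans (Mr _ jN)) ?rM.
have Muniq i j x : (i < N)%N -> (j < N)%N ->
    M i < x < M i.+1 -> M j < x < M j.+1 -> i = j.
  wlog : i j / (i <= j)%N.
    by move=> H; case: (leqP i j) => [/H//|/ltnW/H {}H iN jN xi xj];
      exact/esym/H.
  rewrite leq_eqVlt => /predU1P[//|ij iN jN /andP[_ xi] /andP[xj _]].
  by have := Mle _ _ ij (ltnW jN); rewrite leNgt (lt_trans xj xi).
have MN : (0 < N)%N -> M N = t0 + two_pi R.
  by case: N {mP Mr rM KM Mle Muniq rlt rlo srl} @M => // n /= _; rewrite ltnn.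
have M0 : M 0%N = t0 by [].
clearbody M.
have M_ge0 i : (i <= N)%N -> t0 <= M i by rewrite -M0; exact: Mle.
have M_le i : (0 < N)%N -> (i <= N)%N -> M i <= t0 + two_pi R.
  by move=> N0 iN; rewrite -MN // Mle.
(* The exit point reached from [t] lies before the next cut, so it is [r i]. *)
have exitM i t : (i < N)%N -> M i < t < M i.+1 -> K (angle t) ->
    t <= r i /\ forall s, t <= s <= r i -> K (angle s).
  move=> iN /andP[it ti] Kt.
  have [r' [tr' r'i or' Kr']] := exit_exists (ltW ti) Kt (@KM _).
  suff -> : r i = r' by [].
  have N0 : (0 < N)%N by exact: leq_ltn_trans iN.
  have /nthP-/(_ 0)[j jN Er] : r' \in rl.
    apply: rlP => //; rewrite (le_trans (M_ge0 i _)) ?(ltnW iN) //=; last first.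
      by rewrite (le_trans (ltW it)).
    by rewrite (lt_le_trans r'i) ?M_le.
  rewrite srl in jN; rewrite -Er; congr r.
  apply: (@Muniq _ _ r') => //; first by rewrite r'i (lt_le_trans it).
  by rewrite -Er Mr ?rM.
exists [seq angle (M i) | i <- iota 0 N]; split.
  by move=> p /mapP[i _ ->]; exact: KM.
move=> B KB BM.
pose C (i : 'I_N) := @angle R @` [set t | M i < t < M i.+1 /\ K (angle t)].
pose W (i : 'I_N) := @angle R @` `]M i, M i.+1[.
apply: (@rank_cech_incl_pieces _ _ _ _ _ C W) => //.
- move=> i; apply: connected_continuous_connected; last first.
    exact/continuous_subspaceT/continuous_angle.
  apply/connected_intervalP => x y [/andP[x1 x2] Kx] [/andP[y1 y2] Ky] z
    /andP[xz zy].
  split; first by rewrite (lt_le_trans x1 xz) (le_lt_trans zy y2).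
  have xi : M i < x < M i.+1 by rewrite x1.
  have yi : M i < y < M i.+1 by rewrite y1.
  have [_ xri] := exitM i x (ltn_ord i) xi Kx.
  have [yr _] := exitM i y (ltn_ord i) yi Ky.
  by apply: xri; rewrite xz (le_trans zy).
- move=> i; exists (angle (r i)); exists (r i) => //=; rewrite Mr ?rM //;
  split=> //.
  by apply: outK; have [] := rlo i.
- by move=> i p [t [tM _] <-]; exists t => //=; rewrite in_itv.
- move=> i; apply: open_angle_itv.
  rewrite (le_trans (M_le _ _ _)) ?(leq_ltn_trans _ (ltn_ord i)) //.
  by rewrite lerD2r M_ge0 // ltnW.
- move=> i j [p [[x /=]]]; rewrite in_itv /= => xi <- [y /=];
  rewrite in_itv /= => yj.
  have N0 : (0 < N)%N by exact: leq_ltn_trans (ltn_ord i).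
  move=> /angle_eqP exy; apply/val_inj/(@Muniq _ _ x) => //=.
  rewrite -exy // ltr_norml.
  have := M_le i.+1 N0 (ltn_ord i); have := M_le j.+1 N0 (ltn_ord j).
  have := M_ge0 i (ltnW (ltn_ord i)); have := M_ge0 j (ltnW (ltn_ord j)).
  by move: xi yj => /andP[? ?] /andP[? ?] *; apply/andP; split; lra.
- apply/seteqP; split=> [p [i _ [t [_ Kt] <-]]//|p Kp].
  have [/andP[t1 t2] tp] := LP p.
  have KLp : K (angle (L p)) by rewrite tp.
  have [r' [tr' r'i or' Kr']] := exit_exists (ltW t2) KLp ltac:(by rewrite
    angleD2pi).
  have /nthP-/(_ 0)[j jN Er] : r' \in rl by apply: rlP;
    rewrite // r'i (le_trans t1).
  rewrite srl in jN; exists (Ordinal jN) => //; exists (L p) => //; split=> //=.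
  rewrite (le_lt_trans tr') -?Er ?rM // andbT ltNge; apply/negP => LM.
  by apply: (@KM j); apply: Kr'; rewrite LM -Er ltW ?Mr.
- move=> i0 p Bp; have N0 : (0 < N)%N by exact: leq_ltn_trans (ltn_ord i0).
  have [/andP[t1 t2] tp] := LP p.
  have exj : exists j, (j <= N)%N && (L p < M j) by exists N; rewrite leqnn MN.
  case: (ex_minnP exj) => -[|i] /andP[iN Li] imin.
    by move: Li; rewrite M0 ltNge t1.
  exists (Ordinal iN) => //; exists (L p) => //=; rewrite in_itv /= Li andbT.
  have : M i <= L p.
    rewrite leNgt; apply/negP => Li'.
    by have := imin i; rewrite Li' (ltnW iN) ltnn => /(_ isT).
  rewrite le_eqVlt => /predU1P[E|//]; exfalso; apply: (BM p) => //.
  by apply/mapP; exists i; rewrite ?mem_iota // E tp.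
Unshelve. all: by end_near.
Qed.

End Arcs.

(** * Ranks of sublevel sets *)

Section Sublevel.
Variable R : realType.
Implicit Types (phi dphi psi dpsi : circle R -> R).

(** The full circle has rank one although it has no exit point; this is the
    correction term in [rank_sublevel]. *)
Lemma rank_cech_incl_circle : rank_cech_incl R [set: circle R] setT 1.
Proof.
apply: (@rank_cech_incl_pieces _ _ _ _ _ (fun=> setT) (fun=> setT)) => //.
- by move=> _; exact: connected_circle.
- by move=> _; exists (angle 0).
- by move=> _; exact: openT.
- by move=> i j _; rewrite !ord1.
- by apply/seteqP; split=> // p _; exists ord0.
- by move=> _ p _; exists ord0.
Qed.

Definition has_derivative phi dphi : Prop :=
  forall t : R, is_derive t 1 (phi \o @angle R) (dphi (angle t)).

Definition regular phi dphi a : Prop := forall p, phi p = a -> dphi p != 0.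

Lemma has_derivativeN phi dphi :
  has_derivative phi dphi -> has_derivative (\- phi) (\- dphi).
Proof. by move=> d t; exact: is_deriveN. Qed.

Lemma regularN phi dphi a :
  regular phi dphi a -> regular (\- phi) (\- dphi) (- a).
Proof. by move=> r p /oppr_inj/r; rewrite oppr_eq0. Qed.

Lemma has_derivative_continuous phi dphi :
  has_derivative phi dphi -> continuous phi.
Proof.
move=> d; apply: continuous_circle => t.
by apply/differentiable_continuous/derivable1_diffP; have [] := d t.
Qed.

Lemma is_derive_gt0_near (F : R -> R) (t d : R) : is_derive t 1 F d -> 0 < d ->
  \forall s \near t^'+, F t < F s.
Proof.
move=> /is_derive1_caratheodory[g [Fg gc gt]] d0.
have : \forall s \near t, 0 < g s.
  by rewrite -gt in d0; exact: (cvgr_gt _ gc).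
move=> H; near=> s.
rewrite -subr_gt0 Fg mulr_gt0 ?subr_gt0 //.
by near: s; apply: cvg_within.
Unshelve. all: by end_near. Qed.

Lemma is_derive_lt0_near (F : R -> R) (t d : R) : is_derive t 1 F d -> d < 0 ->
  \forall s \near t^'+, F s < F t.
Proof.
move=> dF d0; have dN : 0 < - d by rewrite oppr_gt0.
have := is_derive_gt0_near (is_deriveN dF) dN.
by apply: filterS => s /=; rewrite ltrN2.
Qed.

Definition sublevel phi psi a b : set (circle R) :=
  [set p | phi p <= a /\ psi p <= b].

Definition rising dphi psi b (Z : seq (circle R)) : nat :=
  count (fun p => (0 < dphi p) && (psi p < b)) Z.

Definition enumerates (s : seq (circle R)) (A : set (circle R)) :=
  uniq s /\ forall p, p \in s <-> A p.

(** At a regular value a level is crossed with nonzero speed, so a boundary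
    point of the sublevel set is left at once or not at all according to the
    sign of the derivative; away from corners only one inequality is tight. *)
Lemma sublevel_exit phi dphi psi dpsi a b :
  has_derivative phi dphi -> has_derivative psi dpsi ->
  regular phi dphi a -> regular psi dpsi b ->
  (forall p, phi p = a -> psi p <> b) ->
  let out := [set p | [/\ phi p = a, 0 < dphi p & psi p < b] \/
                      [/\ psi p = b, 0 < dpsi p & phi p < a]] in
  let K := sublevel phi psi a b in
  (forall t, K (angle t) -> ~ out (angle t) ->
     \forall s \near t^'+, K (angle s)) /\
  (forall t, out (angle t) -> \forall s \near t^'+, ~ K (angle s)).
Proof.
move=> dp dq rp rq pq out K.
have near_lt f df (t c : R) : has_derivative f df -> f (angle t) < c ->
    \forall s \near t^'+, f (angle s) < c.
  move=> df_ fc.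
  have cf : {for t, continuous (f \o @angle R)}.
    by apply/differentiable_continuous/derivable1_diffP; have [] := df_ t.
  exact/cvg_within/(cvgr_lt _ cf).
split=> t.
  move=> [Kp Kq] no.
  have near_le f df c : has_derivative f df -> regular f df c ->
      f (angle t) <= c -> (f (angle t) = c -> ~ 0 < df (angle t)) ->
      \forall s \near t^'+, f (angle s) <= c.
    move=> df_ fr; rewrite le_eqVlt => /predU1P[E /(_ E)/negP|l _]; last first.
      by have := near_lt _ _ _ _ df_ l; apply: filterS => s /ltW.
    rewrite -leNgt le_eqVlt (negbTE (fr _ E)) /= => l.
    by have := is_derive_lt0_near (df_ t) l; apply: filterS => s /=;
      rewrite E => /ltW.
  have H1 := near_le _ _ _ dp rp Kp; have H2 := near_le _ _ _ dq rq Kq.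
  suff [H1' H2'] : (phi (angle t) = a -> ~ 0 < dphi (angle t)) /\
      (psi (angle t) = b -> ~ 0 < dpsi (angle t)).
    by near=> s; split; near: s; [exact: H1|exact: H2].
  split=> E l; apply: no; [left|right]; split=> //.
    by rewrite lt_neqAle Kq andbT; apply/eqP/pq.
  by rewrite lt_neqAle Kp andbT; apply/eqP => E'; exact: pq E.
case=> -[E l _].
  by have := is_derive_gt0_near (dp t) l; apply: filterS => s /=;
    rewrite E ltNge =>
    /negP + [].
by have := is_derive_gt0_near (dq t) l; apply: filterS => s /=;
  rewrite E ltNge =>
    /negP + [].
Unshelve. all: by end_near. Qed.

Lemma lt_gap (a m : R) : a < m ->
  exists2 d, 0 < d & forall a', a' <= a + d -> a' < m.
Proof.
move=> am; exists ((m - a) / 2); first by rewrite divr_gt0 ?subr_gt0.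
by move=> a' ?; lra.
Qed.

(** For nearby levels the larger sublevel set avoids the finitely many cuts
    between the components of the smaller one, so the rank is the number of
    components of the smaller one. Each component other than the full circle has
    one exit point, where one of the functions rises through its level. *)
Lemma rank_sublevel phi dphi psi dpsi a b (Zp Zq : seq (circle R)) :
  has_derivative phi dphi -> has_derivative psi dpsi ->
  regular phi dphi a -> regular psi dpsi b ->
  enumerates Zp [set p | phi p = a] -> enumerates Zq [set p | psi p = b] ->
  (forall p, phi p = a -> psi p <> b) ->
  exists2 e, 0 < e & forall a' b', a < a' <= a + e -> b < b' <= b + e ->
    rank_cech_incl R (sublevel phi psi a b) (sublevel phi psi a' b')
      (rising dphi psi b Zp + rising dpsi phi a Zq +
       `[< sublevel phi psi a b = setT >]).
Proof.
move=> dp dq rp rq [up Zp_] [uq Zq_] pq.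
pose K := sublevel phi psi a b.
pose out := [set p | [/\ phi p = a, 0 < dphi p & psi p < b] \/
                      [/\ psi p = b, 0 < dpsi p & phi p < a]].
have [stay leave] := sublevel_exit dp dq rp rq pq.
pose rs := [seq p <- Zp | (0 < dphi p) && (psi p < b)] ++
           [seq p <- Zq | (0 < dpsi p) && (phi p < a)].
have urs : uniq rs.
  rewrite cat_uniq !filter_uniq //= andbT; apply/hasPn => p.
  rewrite !mem_filter => /andP[_ /Zq_ E]; apply/negP => /andP[_ /Zp_ /pq];
    exact.
have rsP p : p \in rs <-> out p.
  rewrite mem_cat !mem_filter; split.
    by move=> /orP[/andP[/andP[? ?] /Zp_]|/andP[/andP[? ?] /Zq_]]; [left|right].
  move=> [[/Zp_ -> -> ->]//|[/Zq_ -> -> ->]]; exact: orbT.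
have Kclosed : closed K.
  have cl f df c : has_derivative f df -> closed [set p | f p <= c].
    by move/has_derivative_continuous/continuous_closedP => /(_ _ (@closed_le _
      c)).
  exact: closedI (cl _ _ a dp) (cl _ _ b dq).
have outK : out `<=` K.
  by move=> p [[E _ /ltW l]|[E _ /ltW l]]; split; rewrite ?E.
have [KT|KT] := asboolP (K = setT).
  exists 1 => // a' b' /andP[aa' _] /andP[bb' _].
  have -> : sublevel phi psi a' b' = setT.
    apply/seteqP; split=> // p _; have [? ?] : K p by rewrite KT.
    by split; [exact: le_trans (ltW aa')|exact: le_trans (ltW bb')].
  rewrite /rising -!size_filter -size_cat -/rs.
  suff -> : rs = [::] by rewrite -/K KT; exact: rank_cech_incl_circle.
  case E : rs => [//|p s]; exfalso.
  have /rsP : p \in rs by rewrite E mem_head.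
  have [t _ tp] := angle_lift 0 p; rewrite -tp => /leave lv.
  near t^'+ => s'.
  suff : ~ K (angle s') by rewrite KT; apply.
  by near: s'; exact: lv.
have [ms [mK Hms]] := rank_arcs Kclosed stay outK leave urs rsP KT.
have [e e0 He] : exists2 e, 0 < e & forall a' b', a' <= a + e -> b' <= b + e ->
    forall p, p \in ms -> ~ sublevel phi psi a' b' p.
  elim: ms mK {Hms} => [|m ms IH] mK; first by exists 1.
  have [|e e0 He] := IH; first by move=> p pm; apply: mK; rewrite inE pm orbT.
  have [d d0 Hd] : exists2 d, 0 < d & forall a' b', a' <= a + d -> b' <= b + d
    ->
      ~ sublevel phi psi a' b' m.
    have nK := mK m (mem_head _ _).
    have [/lt_gap[d d0 Hd]|ma] := ltP a (phi m).
      by exists d => // a' b' /Hd + _ [] => /lt_geF ->.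
    have [/lt_gap[d d0 Hd]|mb] := ltP b (psi m); last by case: nK.
    by exists d => // a' b' _ /Hd + [_] => /lt_geF ->.
  exists (Num.min e d); first by rewrite lt_min e0.
  move=> a' b'; rewrite !addr_minr !le_min => /andP[ae ad] /andP[be bd] p.
  by rewrite inE => /predU1P[->|]; [exact: Hd|exact: He].
exists e => // a' b' /andP[aa' ae] /andP[bb' be].
rewrite addn0 /rising -!size_filter -size_cat; apply: Hms; last exact: He.
by move=> p [? ?]; split; [exact: le_trans (ltW aa')|exact: le_trans (ltW bb')].
Unshelve. all: by end_near. Qed.

(** Stated for coordinate functions rather than planar maps, so that they can be
    negated and exchanged one at a time. *)
Definition same_rank phi psi phi' psi' : Prop :=
  forall a b a' b', a < a' -> b < b' -> forall k,
    rank_cech_incl R (sublevel phi psi a b) (sublevel phi psi a' b') k <->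
    rank_cech_incl R (sublevel phi' psi' a b) (sublevel phi' psi' a' b') k.

(** The term for the full circle is the same on both sides, and cancels. *)
Lemma same_count phi dphi psi dpsi phi' dphi' psi' dpsi' a b
    (Zp Zq Zp' Zq' : seq (circle R)) :
  same_rank phi psi phi' psi' ->
  has_derivative phi dphi -> has_derivative psi dpsi ->
  has_derivative phi' dphi' -> has_derivative psi' dpsi' ->
  regular phi dphi a -> regular psi dpsi b ->
  regular phi' dphi' a -> regular psi' dpsi' b ->
  enumerates Zp [set p | phi p = a] -> enumerates Zq [set p | psi p = b] ->
  enumerates Zp' [set p | phi' p = a] -> enumerates Zq' [set p | psi' p = b] ->
  (forall p, phi p = a -> psi p <> b) -> (forall p, phi' p = a -> psi' p <> b)
    ->
  (sublevel phi psi a b = setT <-> sublevel phi' psi' a b = setT) ->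
  (rising dphi psi b Zp + rising dpsi phi a Zq =
   rising dphi' psi' b Zp' + rising dpsi' phi' a Zq')%N.
Proof.
move=> S dp dq dp' dq' rp rq rp' rq' Ep Eq Ep' Eq' pq pq' /asbool_equiv_eq KT.
have [e e0 H] := rank_sublevel dp dq rp rq Ep Eq pq.
have [e' e'0 H'] := rank_sublevel dp' dq' rp' rq' Ep' Eq' pq'.
pose d := Num.min e e'.
have d0 : 0 < d by rewrite lt_min e0.
have ad c : c < c + d by rewrite ltrDl.
have de c : c + d <= c + e by rewrite lerD2l ge_min lexx.
have de' c : c + d <= c + e' by rewrite lerD2l ge_min lexx orbT.
apply/eqP; rewrite -(eqn_add2r `[< sublevel phi psi a b = setT >]); apply/eqP.
rewrite [in RHS]KT.
have {}H := H (a + d) (b + d); rewrite !ad !de in H.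
have {}H' := H' (a + d) (b + d); rewrite !ad !de' in H'.
apply: rank_cech_incl_uniq (H' isT isT).
by apply/(S _ _ _ _ (ad a) (ad b)); exact: H.
Qed.

End Sublevel.

(** * Regular values *)

Section Sard.
Variable R : realType.
Implicit Types phi dphi : circle R -> R.

Lemma near_neq (f : R -> R) (t a : R) : {for t, continuous f} -> f t != a ->
  \forall s \near t, f s != a.
Proof.
move=> fc fa; have : (f s - a) @[s --> t] --> f t - a by apply: cvgB;
  [|exact: cvg_cst].
by move=> /cvgr_neq0; rewrite subr_eq0 => /(_ fa); apply: filterS => s;
  rewrite subr_eq0.
Qed.

(** The points of a regular fibre are isolated, and the circle is compact. *)
Lemma finite_fibre phi dphi a :
  has_derivative phi dphi -> regular phi dphi a ->
  exists Z, enumerates Z [set p | phi p = a].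
Proof.
move=> dp rp.
have /choice[e He] : forall t : R, exists e, 0 < e /\
    forall s, `|t - s| < e -> phi (angle s) = a -> s = t.
  move=> t.
  suff /nbhs_ballP[e /= e0 He] : \forall s \near t, phi (angle s) = a -> s = t.
    by exists e; split=> // s ts; exact: He.
  have /is_derive1_caratheodory[g [Fg gc gt]] := dp t.
  have [ta|ta] := eqVneq (phi (angle t)) a; last first.
    have : \forall s \near t, phi (angle s) != a.
      have cf : {for t, continuous (phi \o @angle R)}.
        by apply/differentiable_continuous/derivable1_diffP; have [] := dp t.
      exact: near_neq cf ta.
    by apply: filterS => s /eqP.
  have : \forall s \near t, g s != 0.
    by apply: near_neq gc _; rewrite gt; exact: rp.
  apply: filterS => s gs sa; have := Fg s.
  rewrite /= sa ta subrr => /esym/eqP; rewrite mulf_eq0 (negbTE gs) subr_eq0.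
  by move/eqP.
have : compact `[0, two_pi R]%classic by exact: segment_compact.
rewrite compact_cover => /(_ _ setT (fun t => ball t (e t)))[].
- by move=> t _; apply: ball_open; exact: (He t).1.
- by move=> t _; exists t => //; apply: ballxx; exact: (He t).1.
move=> D _ cD.
exists (undup [seq p <- [seq angle t | t <- finmap.enum_fset D] | phi p == a]);
  split.
  exact: undup_uniq.
move=> p; rewrite mem_undup mem_filter; split=> [/andP[/eqP]//|pa].
rewrite /= pa eqxx /=; have [t /andP[t0 t1] tp] := angle_lift 0 p.
have [|t' t'D tt'] := cD t;
  first by rewrite /= in_itv /= t0 -[two_pi R]add0r ltW.
have -> : p = angle t' by rewrite -tp ((He t').2 t tt') // tp.
exact: map_f.
Qed.

Local Notation mu := (@lebesgue_measure R).

Lemma critical_uniform dphi : continuous (dphi \o @angle R) ->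
  forall e : R, 0 < e -> exists2 d : R, 0 < d & forall t s : R, 0 <= t <=
    two_pi R ->
    dphi (angle t) = 0 -> `|s - t| < d -> `|dphi (angle s)| < e.
Proof.
move=> dc e e0.
suff H : \forall d \near (0 : R)^'+, `[0, two_pi R]%classic `<=` (fun t =>
    dphi (angle t) = 0 -> forall s, `|s - t| < d -> `|dphi (angle s)| < e).
  near (0 : R)^'+ => d; exists d => // t s t01 t0 st.
  by apply: (near H d) st => //=; rewrite in_itv.
have /compact_near_coveringP cov := @segment_compact R 0 (two_pi R).
apply: cov.
- move=> t _; have [t0|t0] := eqVneq (dphi (angle t)) 0; last first.
    near=> t' d => /= t'0; exfalso; move: t'0; apply/eqP.
    by near: t'; exact: near_neq (dc t) t0.
  have : \forall s \near t, `|dphi (angle s)| < e.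
    have : `|(dphi \o @angle R) s| @[s --> t] --> `|dphi (angle t)|.
      by apply: cvg_norm; exact: dc.
    by rewrite t0 normr0 => /cvgr_lt/(_ _ e0).
  move=> /nbhs_ballP[r /= r0 Hr]; have r20 : 0 < r / 2 by rewrite divr_gt0.
  exists (ball t (r / 2), [set d | d < r / 2]) => /=.
    by split; [exact: nbhsx_ballx|exact: nbhs_right_lt].
  move=> [t' d] /= [tt' dr] _ s ss; apply: Hr.
  rewrite /ball /= (le_lt_trans (ler_distD t' _ _)) // (splitr r) ltrD //.
  by rewrite distrC (lt_trans ss).
Unshelve. all: by end_near. Qed.

Lemma measurable_critical_values phi dphi : has_derivative phi dphi ->
  continuous (dphi \o @angle R) ->
  measurable (phi @` [set p | dphi p = 0%R]).
Proof.
move=> dp dc; apply: measurable_realfun.compact_measurable.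
apply: continuous_compact.
  apply: continuous_subspaceT; exact: has_derivative_continuous dp.
apply: subclosed_compact (@compact_circle R) _ => //.
have /continuous_closedP := continuous_circle dc.
by move=> /(_ [set 0%R] (@closed_eq _ 0%R)).
Qed.

(** Cut the circle into [N] short arcs: near a critical point the derivative is
    small, so the critical values on one arc fill an interval much shorter than
    the arc. *)
Lemma critical_values_measure phi dphi (e : R) : has_derivative phi dphi ->
  continuous (dphi \o @angle R) -> 0 < e ->
  (mu (phi @` [set p | dphi p = 0%R]) <= e%:E)%E.
Proof.
move=> dp dc e0; pose F := phi \o @angle R.
have tp0 := two_pi_gt0 R.
have [|d d0 Hd] := @critical_uniform _ dc (e / (two_pi R *+ 2)).
  by rewrite divr_gt0 // mulrn_wgt0.
pose N := Num.bound (two_pi R / d).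
have tauN : two_pi R / d < N%:R by apply: archi_boundP; rewrite ltW ?divr_gt0.
have N0 : 0 < N%:R :> R by rewrite (lt_trans _ tauN) ?divr_gt0.
have tn0 : two_pi R != 0 by rewrite gt_eqF.
have Nn0 : N%:R != 0 :> R by rewrite gt_eqF.
clearbody N; pose h := e / N%:R / 2.
pose J i := `[F (two_pi R * i%:R / N%:R) - h, F (two_pi R * i%:R / N%:R) +
  h]%classic.
apply: (@le_trans _ _ (mu (\big[setU/set0]_(i < N) J i))).
  apply: le_measure; rewrite ?inE.
  - exact: measurable_critical_values.
  - by apply: bigsetU_measurable => i _; exact: measurable_itv.
  move=> _ [p /= p0 <-].
  have [t /andP[t0 t1] tp] := angle_lift 0 p; rewrite add0r in t1.
  pose i := Num.trunc (t * N%:R / two_pi R).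
  have tN : 0 <= t * N%:R / two_pi R by rewrite divr_ge0 ?mulr_ge0 // ltW.
  have /andP[it ti] := truncn_itv tN; rewrite -/i in it ti.
  have iN : (i < N)%N.
    by rewrite -(@ltr_nat R) (le_lt_trans it) // ltr_pdivrMr // mulrC ltr_pM2l.
  pose s := two_pi R * i%:R / N%:R.
  have st : s <= t.
    by move: it; rewrite /s ler_pdivlMr // ler_pdivrMr // mulrC.
  have tsd : t - s < two_pi R / N%:R.
    move: ti; rewrite /s ltr_pdivrMr // -natr1 => ti.
    by rewrite ltr_pdivlMr // mulrBl divfK ?gt_eqF //; lra.
  have taud : two_pi R / N%:R < d.
    by move: tauN; rewrite ltr_pdivrMr // ltr_pdivrMr // mulrC.
  have [c cst Ec] : exists2 c, c \in `[s, t] & F t - F s = dphi (angle c) * (t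
    - s).
    apply: (@MVT_segment _ F (dphi \o @angle R)) => //.
    apply: continuous_subspaceT => x.
    by apply/differentiable_continuous/derivable1_diffP; have [] := dp x.
  rewrite -bigcup_mkord; exists i => //.
  rewrite /J /= in_itv /= -/s -ler_distl -tp -/(F t).
  have /andP[sc ct] : s <= c <= t by move: cst; rewrite in_itv.
  have dc_ : `|dphi (angle c)| < e / (two_pi R *+ 2).
    apply: (Hd t); rewrite ?t0 ?ltW ?tp //.
    by rewrite distrC ger0_norm ?subr_ge0 //; lra.
  rewrite Ec normrM (ger0_norm (_ : 0 <= t - s)) ?subr_ge0 //.
  have -> : h = e / (two_pi R *+ 2) * (two_pi R / N%:R).
    by move: (two_pi R) tn0 => T T0; rewrite /h mulr2n; field; rewrite Nn0 T0.
  by apply: ler_pM; rewrite ?normr_ge0 ?subr_ge0 //; exact: ltW.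
apply: (le_trans (le_mu_bigsetU _ _)) => [i _|]; first exact: measurable_itv.
have muJ i : mu (J i) = (e / N%:R)%:E.
  rewrite /J lebesgue_measure_itv /= lte_fin.
  have h0 : 0 < h by rewrite !divr_gt0.
  rewrite ifT; last by lra.
  by rewrite -EFinB; congr EFin; rewrite /h; field.
rewrite (eq_bigr (fun=> (e / N%:R)%:E)) => [|i _]; last exact: muJ.
rewrite sumEFin lee_fin sumr_const card_ord -[X in X <= _]mulr_natr divfK //.
Qed.

Lemma critical_negligible phi dphi : has_derivative phi dphi ->
  continuous (dphi \o @angle R) ->
  mu.-negligible (phi @` [set p | dphi p = 0%R]).
Proof.
move=> dp dc; apply/negligibleP.
  exact: measurable_critical_values.
apply/eqP; rewrite eq_le measure_ge0 andbT; apply/lee_addgt0Pr => e e0.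
by rewrite add0e; exact: critical_values_measure.
Qed.

(** The critical values of both functions and the values to be avoided form a
    negligible set, which contains no interval. *)
Lemma exists_regular phi dphi phi' dphi' (c d : R) (s : seq R) :
  has_derivative phi dphi -> continuous (dphi \o @angle R) ->
  has_derivative phi' dphi' -> continuous (dphi' \o @angle R) ->
  c < d ->
  exists a, [/\ c < a < d, regular phi dphi a, regular phi' dphi' a & a \notin
    s].
Proof.
move=> dp dc dp' dc' cd; apply: contrapT => H.
have Hs : mu.-negligible [set` s].
  apply/negligibleP.
    apply: countable_measurable (finite_set_countable (finite_seq s)) => t.
    exact: measurable_set1.
  exact: countable_lebesgue_measure0 (finite_set_countable (finite_seq s)).
have N := negligibleU (negligibleU (critical_negligible dp dc)
  (critical_negligible dp' dc')) Hs.
have /negligibleP : mu.-negligible `]c, d[%classic.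
  apply: negligibleS N => a /=; rewrite in_itv /= => acd.
  apply: contrapT => /not_orP[/not_orP[h1 h2] h3].
  apply: H; exists a; split=> //; last exact/negP.
    by move=> p pa; apply/eqP => p0; apply: h1; exists p.
  by move=> p pa; apply/eqP => p0; apply: h2; exists p.
move=> /(_ (measurable_itv _));
  rewrite /= lebesgue_measure_itv /= lte_fin cd -EFinB.
by move=> -[] /eqP; rewrite subr_eq0 gt_eqF.
Qed.

End Sard.

(** * Persistence determines the image *)

Section Image.
Variable R : realType.
Implicit Types (phi dphi psi dpsi : circle R -> R).

Definition C1_function phi dphi : Prop :=
  has_derivative phi dphi /\ continuous (dphi \o @angle R).

Lemma circle_bounded phi dphi : has_derivative phi dphi ->
  exists M, forall p, `|phi p| < M.
Proof.
move=> dp.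
have : compact (phi @` setT).
  apply: continuous_compact (@compact_circle R).
  by apply: continuous_subspaceT; exact: has_derivative_continuous dp.
move=> /compact_bounded[M [_ HM]]; exists (M + 2) => p.
have := HM (M + 1); rewrite ltrDl ltr01 => /(_ isT (phi p)) H.
have /= {}H := H (ex_intro2 _ _ p I erefl).
by rewrite (le_lt_trans H) // ltrD2l ltr1n.
Qed.

Lemma same_rankC phi psi phi' psi' :
  same_rank phi psi phi' psi' -> same_rank psi phi psi' phi'.
Proof.
have swap (f g : circle R -> R) a b : sublevel f g a b = sublevel g f b a.
  by apply/seteqP; split=> p [].
by move=> S a b a' b' aa' bb' k; rewrite ![sublevel psi _ _ _]swap
  ![sublevel psi' _ _ _]swap; exact: S.
Qed.

Lemma same_rank_sym phi psi phi' psi' :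
  same_rank phi psi phi' psi' -> same_rank phi' psi' phi psi.
Proof. by move=> S a b a' b' aa' bb' k; symmetry; exact: S. Qed.

(** Rank zero detects empty sublevel sets of [- phi], that is, upper bounds of
    [phi]. *)
Lemma same_rank_ub phi psi phi' psi' (M a : R) :
  same_rank (\- phi) psi (\- phi') psi' -> (forall p, psi' p <= M) ->
  (forall p, phi p <= a) -> forall p, phi' p <= a.
Proof.
move=> S M' pa q; rewrite leNgt; apply/negP => aq.
have e : sublevel (\- phi) psi (- phi' q) M = set0.
  apply/seteqP; split=> // p [/=]; rewrite lerN2 => qp _.
  by have := pa p; rewrite leNgt (lt_le_trans aq).
have r0 : rank_cech_incl R (sublevel (\- phi) psi (- phi' q) M)
    (sublevel (\- phi) psi (- phi' q + 1) (M + 1)) 0.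
  rewrite e; apply: (@rank_cech_incl_pieces _ _ _ _ _ (fun=> set0) (fun=>
    set0));
    try by case.
  by apply/seteqP; split=> // p [[]].
have q1 : - phi' q < - phi' q + 1 by rewrite ltrDl.
have M1 : M < M + 1 by rewrite ltrDl.
have /rank_cech_incl_eq0 E := (S _ _ _ _ q1 M1 0%N).1 r0.
suff : sublevel (\- phi') psi' (- phi' q) M q.
  rewrite E // => p [? ?]; split; first exact: le_trans (ltW q1).
  exact: le_trans (ltW M1).
by split.
Qed.

Lemma same_rank_ub_iff phi psi phi' psi' (M M' a : R) :
  same_rank (\- phi) psi (\- phi') psi' ->
  (forall p, psi p <= M) -> (forall p, psi' p <= M') ->
  (forall p, phi p <= a) <-> (forall p, phi' p <= a).
Proof.
move=> S pM pM'; split; first exact: same_rank_ub S pM'.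
exact: same_rank_ub (same_rank_sym S) pM.
Qed.

Lemma sublevel_setT phi psi a b : sublevel phi psi a b = setT <->
  (forall p, phi p <= a) /\ (forall p, psi p <= b).
Proof.
split=> [E|[pa pb]].
  by split=> p; have [] : sublevel phi psi a b p by rewrite E.
by apply/seteqP; split=> // p _; split.
Qed.

Definition same_ranks phi psi phi' psi' : Prop :=
  [/\ same_rank phi psi phi' psi', same_rank (\- phi) psi (\- phi') psi' &
      same_rank phi (\- psi) phi' (\- psi')].

Lemma same_ranksC phi psi phi' psi' :
  same_ranks phi psi phi' psi' -> same_ranks psi phi psi' phi'.
Proof. by move=> [S1 S2 S3]; split; exact: same_rankC. Qed.

Lemma same_ranks_sym phi psi phi' psi' :
  same_ranks phi psi phi' psi' -> same_ranks phi' psi' phi psi.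
Proof. by move=> [S1 S2 S3]; split; exact: same_rank_sym. Qed.

Lemma oppr_funK (f : circle R -> R) : \- (\- f) = f.
Proof. by apply/funext => p /=; rewrite opprK. Qed.

Lemma count_split (T : eqType) (a b c : pred T) (s : seq T) :
  {in s, forall x, (a x + b x = c x)%N} ->
  (count a s + count b s = count c s)%N.
Proof.
elim: s => //= x s IH H; rewrite -IH => [|y ys]; last by apply: H;
  rewrite inE ys orbT.
by have := H x (mem_head _ _); lia.
Qed.

(** Inclusion-exclusion for the two quadrants that make up a half plane: their
    exit points on the vertical line are those of the half plane, and on the
    horizontal ray between them every point is an exit point of exactly one. *)
Lemma same_count_ray phi dphi psi dpsi phi' dphi' psi' dpsi' x y
    (Z Z' : seq (circle R)) :
  same_ranks phi psi phi' psi' ->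
  has_derivative phi dphi -> has_derivative psi dpsi ->
  has_derivative phi' dphi' -> has_derivative psi' dpsi' ->
  regular phi dphi x -> regular psi dpsi y ->
  regular phi' dphi' x -> regular psi' dpsi' y ->
  enumerates Z [set p | psi p = y] -> enumerates Z' [set p | psi' p = y] ->
  x \notin map phi Z -> x \notin map phi' Z' ->
  count (fun p => phi p < x) Z = count (fun p => phi' p < x) Z'.
Proof.
move=> [S1 S2 S3] dp dq dp' dq' rp rq rp' rq' EZ EZ' xZ xZ'.
have [V EV] := finite_fibre dp rp; have [V' EV'] := finite_fibre dp' rp'.
have off (f g : circle R -> R) (Y : seq (circle R)) : enumerates Y [set p | g p
  = y] ->
    x \notin map f Y -> forall p, f p = x -> g p <> y.
  by move=> [_ YP] xY p px /YP pY; case/negP: xY; rewrite -px map_f.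
have pq := off phi psi Z EZ xZ; have pq' := off phi' psi' Z' EZ' xZ'.
have [Mp Hp] := circle_bounded dp; have [Mp' Hp'] := circle_bounded dp'.
have [Mq Hq] := circle_bounded dq; have [Mq' Hq'] := circle_bounded dq'.
have ub (f : circle R -> R) N : (forall p, `|f p| < N) -> forall p, f p <= N.
  by move=> H p; rewrite ltW // (le_lt_trans (ler_norm _)).
(* Above the level [M], quadrants become half planes. *)
pose M := Num.max Mq Mq'.
have ltM p : psi p < M.
  by rewrite (le_lt_trans (ler_norm _)) // (lt_le_trans (Hq p)) // le_max lexx.
have ltM' p : psi' p < M.
  by rewrite (le_lt_trans (ler_norm _)) // (lt_le_trans (Hq' p)) // le_max lexx
    orbT.
have Bp a := same_rank_ub_iff a S2 (ub _ _ Hq) (ub _ _ Hq').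
have Bq b := same_rank_ub_iff b (same_rankC S3) (ub _ _ Hp) (ub _ _ Hp').
have BNq b : (forall p, - psi p <= b) <-> (forall p, - psi' p <= b).
  apply: (@same_rank_ub_iff (\- psi) phi (\- psi') phi' Mp Mp'); try exact: ub.
  by rewrite !oppr_funK; exact: same_rankC.
have C1 := same_count S1 dp dq dp' dq' rp rq rp' rq' EV EZ EV' EZ' pq pq'.
have {}C1 := C1 ltac:(by rewrite !sublevel_setT Bp Bq).
have enumN (f : circle R -> R) (Y : seq (circle R)) : enumerates Y [set p | f p
  = y] ->
    enumerates Y [set p | (\- f) p = - y].
  by move=> [uY YP]; split=> // p; rewrite YP /=; split=> [->|/oppr_inj].
have offN (f g : circle R -> R) : (forall p, f p = x -> g p <> y) ->
    forall p, f p = x -> (\- g) p <> - y.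
  by move=> H p /H gy /oppr_inj.
have C2 := same_count S3 dp (has_derivativeN dq) dp' (has_derivativeN dq')
  rp (regularN rq) rp' (regularN rq') EV (enumN _ _ EZ) EV' (enumN _ _ EZ')
  (offN _ _ pq) (offN _ _ pq') ltac:(by rewrite !sublevel_setT Bp BNq).
have rM : regular psi dpsi M by move=> p E; have := ltM p; rewrite E ltxx.
have rM' : regular psi' dpsi' M by move=> p E; have := ltM' p; rewrite E ltxx.
have E0 (f : circle R -> R) : (forall p, f p < M) -> enumerates [::] [set p | f
  p = M].
  by move=> H; split=> // p; split=> //= E; have := H p; rewrite E ltxx.
have offM (f g : circle R -> R) : (forall p, g p < M) -> forall p, f p = x -> g
  p <> M.
  by move=> H p _ E; have := H p; rewrite E ltxx.
have C3 := same_count S1 dp dq dp' dq' rp rM rp' rM' EV (E0 _ ltM) EV' (E0 _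
  ltM')
  (offM _ _ ltM) (offM _ _ ltM') ltac:(by rewrite !sublevel_setT Bp Bq).
have split_line (f df g dg : circle R -> R) (W Y : seq (circle R)) :
    enumerates W [set p | f p = x] -> enumerates Y [set p | g p = y] ->
    (forall p, f p = x -> g p <> y) -> (forall p, g p < M) ->
    regular g dg y ->
    (rising df g y W + rising dg f x Y + (rising df (\- g) (- y) W + rising (\-
      dg) f x Y) =
     rising df g M W + count (fun p => (f p < x)%R) Y)%N.
  move=> [_ WP] [_ YP] fg gM rg; rewrite addnACA; congr (_ + _)%N.
    apply: count_split => p /WP /fg/eqP gy; rewrite gM andbT /= ltrN2.
    by case: (0 < df p) => //=; case: ltgtP gy.
  apply: count_split => p /YP gy; rewrite /= oppr_gt0.
  by case: (f p < x); rewrite ?andbF //= !andbT; case: ltgtP (rg _ gy).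
move: C3; rewrite /rising /= !addn0 => C3.
have := split_line _ dphi _ dpsi _ _ EV EZ pq ltM rq.
rewrite C1 C2 (split_line _ dphi' _ dpsi' _ _ EV' EZ' pq' ltM' rq').
by rewrite /rising /= C3 => /addnI.
Qed.
(** The number of points of the level line of [psi] to the left of [x] jumps as
    [x] passes [phi p], so the other curve has a point there too. *)
Lemma fibre_close phi dphi psi dpsi phi' dphi' psi' dpsi' y (p : circle R) (e :
  R) :
  same_ranks phi psi phi' psi' ->
  C1_function phi dphi -> has_derivative psi dpsi ->
  C1_function phi' dphi' -> has_derivative psi' dpsi' ->
  regular psi dpsi y -> regular psi' dpsi' y -> psi p = y -> 0 < e ->
  exists2 q, psi' q = y & `|phi' q - phi p| < e.
Proof.
move=> S [dp dpc] dq [dp' dpc'] dq' rq rq' py e0.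
have [Z EZ] := finite_fibre dq rq; have [Z' EZ'] := finite_fibre dq' rq'.
pose avoid := map phi Z ++ map phi' Z'.
have pe1 : phi p - e < phi p by rewrite gtrBl.
have pe2 : phi p < phi p + e by rewrite ltrDl.
have [x1 [/andP[x1l x1r] r1 r1' av1]] := exists_regular avoid dp dpc dp' dpc'
  pe1.
have [x2 [/andP[x2l x2r] r2 r2' av2]] := exists_regular avoid dp dpc dp' dpc'
  pe2.
move: av1 av2; rewrite !mem_cat !negb_or => /andP[a1 a1'] /andP[a2 a2'].
have C1 := same_count_ray S dp dq dp' dq' r1 rq r1' rq' EZ EZ' a1 a1'.
have C2 := same_count_ray S dp dq dp' dq' r2 rq r2' rq' EZ EZ' a2 a2'.
have [q qZ qx] : exists2 q, q \in Z' & x1 <= phi' q < x2.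
  apply: contrapT => H.
  have : (count (fun p => (phi' p < x2)%R) Z' <= count (fun p => (phi' p <
    x1)%R) Z')%N.
    rewrite (@eq_in_count _ _ (fun q => (phi' q < x2)%R && (phi' q < x1)%R)).
      by apply: sub_count => q /andP[].
    move=> q qZ; apply/esym/andb_idr => qx2; rewrite ltNge; apply/negP => x1q.
    by apply: H; exists q => //; rewrite x1q.
  rewrite -C1 -C2 leqNgt => /negP; apply.
  have pZ : p \in Z by apply/EZ.2.
  have /permP pr := perm_to_rem pZ.
  rewrite !pr /= x2l ltNge (ltW x1r) add0n add1n ltnS;
    apply: sub_count => q /= /lt_trans; apply.
  exact: lt_trans x2l.
exists q; first exact/EZ'.2.
case/andP: qx => ? ?; rewrite ltr_norml; apply/andP; split; lra.
Qed.

(** Where [psi] has nonzero derivative it takes a regular value at some nearby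
    point, to which the comparison of level lines applies. *)
Lemma image_close phi dphi psi dpsi phi' dphi' psi' dpsi' (p : circle R) (e :
  R) :
  same_ranks phi psi phi' psi' ->
  C1_function phi dphi -> C1_function psi dpsi ->
  C1_function phi' dphi' -> C1_function psi' dpsi' ->
  dpsi p != 0 -> 0 < e ->
  exists q, `|phi' q - phi p| < e /\ `|psi' q - psi p| < e.
Proof.
move=> S Cp Cq Cp' Cq' p0 e0; have [t _ tp] := angle_lift 0 p.
have cont f df : C1_function f df -> continuous (f \o @angle R).
  move=> [df_ _] s; apply/differentiable_continuous/derivable1_diffP.
  by have [] := df_ s.
have e20 : 0 < e / 2 by rewrite divr_gt0.
have close f df : C1_function f df -> \forall s \near t, `|f (angle s) - f p| <
  e / 2.
  move=> /cont/(_ t)/cvgrPdist_lt/(_ _ e20); apply: filterS => s /=.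
  by rewrite distrC tp.
have [d [d0 Hp Hq]] : exists d, [/\ 0 < d,
    forall s, `|t - s| < d -> `|phi (angle s) - phi p| < e / 2 &
    forall s, `|t - s| < d -> `|psi (angle s) - psi p| < e / 2].
  have /nbhs_ballP[d1 /= d10 H1] := close _ _ Cp.
  have /nbhs_ballP[d2 /= d20 H2] := close _ _ Cq.
  exists (Num.min d1 d2); split; first by rewrite lt_min d10.
    by move=> s; rewrite lt_min => /andP[sd _]; exact: H1.
  by move=> s; rewrite lt_min => /andP[_ sd]; exact: H2.
have [s [ts sd sp]] : exists s, [/\ t < s, s < t + d & psi (angle s) != psi p].
  have H : \forall s \near t^'+, psi (angle s) != psi (angle t).
    have := p0; rewrite -tp; case: (ltgtP (dpsi (angle t)) 0) => // l _.
      have := is_derive_lt0_near (Cq.1 t) l.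
      by apply: filterS => s /= sl; rewrite lt_eqF.
    have := is_derive_gt0_near (Cq.1 t) l.
    by apply: filterS => s /= sl; rewrite gt_eqF.
  near t^'+ => s; exists s; split=> //.
    by near: s; apply: nbhs_right_lt; rewrite ltrDl.
  by rewrite -tp; near: s.
pose m := Num.min (psi (angle t)) (psi (angle s)).
pose M := Num.max (psi (angle t)) (psi (angle s)).
have mM : m < M by rewrite lt_max !gt_min !ltxx orbF tp -neq_lt.
have [y [/andP[my yM] rq rq' _]] := exists_regular [::] Cq.1 Cq.2 Cq'.1 Cq'.2
  mM.
have [r] := @IVT _ (psi \o @angle R) t s y (ltW ts)
  (continuous_subspaceT (cont _ _ Cq)) ltac:(by rewrite /= (ltW my) ltW).
rewrite in_itv /= => /andP[tr rs] ry.
have rd : `|t - r| < d by rewrite distrC ger0_norm ?subr_ge0 //; lra.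
have [q qy qr] := fibre_close S Cp Cq.1 Cp' Cq'.1 rq rq' ry e20.
exists q; split.
  rewrite (le_lt_trans (ler_distD (phi (angle r)) _ _)) // (splitr e).
  by rewrite ltrD ?Hp.
by rewrite qy -ry (lt_trans (Hq _ rd)) // ltr_pdivrMr // ltr_pMr // ltr1n.
Unshelve. all: by end_near. Qed.

(** The image of a curve is closed, so approximation is enough. *)
Lemma planar_image_sub phi dphi psi dpsi phi' dphi' psi' dpsi' :
  same_ranks phi psi phi' psi' ->
  C1_function phi dphi -> C1_function psi dpsi ->
  C1_function phi' dphi' -> C1_function psi' dpsi' ->
  (forall p, dphi p != 0 \/ dpsi p != 0) ->
  forall p, exists q, phi' q = phi p /\ psi' q = psi p.
Proof.
move=> S Cp Cq Cp' Cq' imm p.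
have approx e : 0 < e -> exists q, `|phi' q - phi p| < e /\ `|psi' q - psi p| <
  e.
  move=> e0; have [p0|p0] := imm p;
    last exact: image_close S Cp Cq Cp' Cq' p0 e0.
  have [q [? ?]] := image_close (same_ranksC S) Cq Cp Cq' Cp' p0 e0.
  by exists q.
apply: contrapT => H.
have /compact_near_coveringP cov := @compact_circle R.
suff N : \forall e \near (0 : R)^'+, [set: circle R] `<=` (fun q =>
    ~ (`|phi' q - phi p| < e /\ `|psi' q - psi p| < e)).
  near (0 : R)^'+ => e; have e0 : 0 < e by [].
  by have [q] := approx e e0; apply: (near N e).
apply: cov => q _.
have away f df c : C1_function f df -> f q <> c ->
    \forall q' \near q & e \near (0 : R)^'+, ~ `|f q' - c| < e.
  move=> [df_ _] /eqP fc; pose d := `|f q - c| / 2.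
  have d0 : 0 < d by rewrite divr_gt0 // normr_gt0 subr_eq0.
  have /cvgrPdist_lt/(_ _ d0) N := has_derivative_continuous df_ (x := q).
  near=> q' e; apply/negP; rewrite -leNgt /=.
  have l1 : `|f q - f q'| < d by near: q'.
  have l2 : e < d by near: e; exact: nbhs_right_lt.
  have := ler_distD (f q') (f q) c; rewrite /d in l1 l2; lra.
have [qp|qp] := pselect (phi' q = phi p).
  have qs : psi' q <> psi p by move=> qs; apply: H; exists q.
  by have := away _ _ _ Cq' qs; apply: filterS => -[q' e] /= n [].
by have := away _ _ _ Cp' qp; apply: filterS => -[q' e] /= n [].
Unshelve. all: by end_near. Qed.

End Image.

(** * Matching two curves with the same image *)

Section Curves.
Variable R : realType.
Implicit Types (x y dx dy : circle R -> R).

(** For immersed curves, the vanishing of the determinant in the last equation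
    says that the tangent lines at [p] and [q] agree. *)
Definition matches x dx y dy x' dx' y' dy' (p q : circle R) : Prop :=
  [/\ x' q = x p, y' q = y p & dx p * dy' q = dy p * dx' q].

Lemma near_det_neq0 (S T : topologicalType) (a b : T -> R) (c d : S -> R)
    (t : T) (s : S) :
  {for t, continuous a} -> {for t, continuous b} ->
  {for s, continuous c} -> {for s, continuous d} ->
  a t * d s - b t * c s != 0 ->
  \forall s' \near s & t' \near t, a t' * d s' - b t' * c s' != 0.
Proof.
move=> ca cb cc cd n0.
pose F (z : S * T) := a z.2 * d z.1 - b z.2 * c z.1.
have FF : F z @[z --> (s, t)] --> F (s, t).
  have l1 (h : S -> R) : {for s, continuous h} -> (h \o fst) z @[z --> (s, t)]
    --> h s.
    by move=> ch; apply: (@cvg_comp _ _ _ fst h _ (nbhs s));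
      [exact: cvg_fst|exact: ch].
  have l2 (h : T -> R) : {for t, continuous h} -> (h \o snd) z @[z --> (s, t)]
    --> h t.
    by move=> ch; apply: (@cvg_comp _ _ _ snd h _ (nbhs t));
      [exact: cvg_snd|exact: ch].
  by apply: cvgB; apply: cvgM; [exact: l2|exact: l1|exact: l2|exact: l1].
exact: cvgr_neq0 FF n0.
Qed.

(** A curve inside another one is tangent to it: near a point [angle t] the
    second curve must pass through the points of the first, and at an
    accumulation point of the matching parameters the slopes of the secants,
    which are common to both curves, converge to both tangents. *)
Lemma tangent_exists x dx y dy x' dx' y' dy' :
  has_derivative x dx -> has_derivative y dy ->
  has_derivative x' dx' -> has_derivative y' dy' ->
  (forall p, dx p != 0 \/ dy p != 0) ->
  (forall p, exists q, x' q = x p /\ y' q = y p) ->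
  forall p, exists q, matches x dx y dy x' dx' y' dy' p q.
Proof.
move=> X Y X' Y' imm im p; have [t _ tp] := angle_lift 0 p.
apply: contrapT => H.
have /is_derive1_caratheodory[a [Xa ac at_]] := X t.
have /is_derive1_caratheodory[b [Yb bc bt]] := Y t.
have cont f df s : has_derivative f df -> {for s, continuous (f \o @angle R)}.
  by move=> df_; apply/differentiable_continuous/derivable1_diffP;
    have [] := df_ s.
have far f df f' df' s : has_derivative f df -> has_derivative f' df' ->
    f' (angle s) != f (angle t) ->
    \forall s' \near s & t' \near t, f' (angle s') != f (angle t').
  move=> df_ df'_ n.
  have c1 : {for t, continuous (cst 1 : R -> R)} by exact: cst_continuous.
  have c1' : {for s, continuous (cst 1 : R -> R)} by exact: cst_continuous.
  have := near_det_neq0 c1 (cont _ _ t df_) c1' (cont _ _ s df'_).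
  rewrite /= mul1r mulr1 subr_eq0 => /(_ n); apply: filterS => -[s' t'] /=.
  by rewrite mul1r mulr1 subr_eq0.
have ab0 : \forall t' \near t, a t' != 0 \/ b t' != 0.
  have [p0|p0] := imm p.
    have : \forall t' \near t, a t' != 0 by apply: near_neq ac _;
      rewrite at_ tp.
    by apply: filterS => t' ?; left.
  have : \forall t' \near t, b t' != 0 by apply: near_neq bc _; rewrite bt tp.
  by apply: filterS => t' ?; right.
pose apart t' s := t' <> t ->
  ~ (x' (angle s) = x (angle t') /\ y' (angle s) = y (angle t')).
suff N : \forall t' \near t, `[0, two_pi R]%classic `<=` apart t'.
  near t^'+ => t'.
  have t't : t' <> t by apply/eqP; rewrite gt_eqF.
  have [q [qx qy]] := im (angle t'); have [s /andP[s0 s1] sq] := angle_lift 0 q.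
  have Nt' : `[0, two_pi R]%classic `<=` apart t' by near: t';
    exact: cvg_within.
  apply: (Nt' s) => //; last by rewrite sq.
  by rewrite /= in_itv /= s0 -[two_pi R]add0r ltW.
have /compact_near_coveringP cov := @segment_compact R 0 (two_pi R).
apply: (cov R (nbhs t) apart) => s _.
have [ex|nx] := eqVneq (x' (angle s)) (x (angle t)); last first.
  by have := far _ _ _ _ _ X X' nx; apply: filterS => -[s' t'] /= /eqP n _ [].
have [ey|ny] := eqVneq (y' (angle s)) (y (angle t)); last first.
  by have := far _ _ _ _ _ Y Y' ny; apply: filterS => -[s' t'] /= /eqP n _ [].
have /is_derive1_caratheodory[c [Xc cc cs]] := X' s.
have /is_derive1_caratheodory[d [Yd dc ds]] := Y' s.
have n0 : a t * d s - b t * c s != 0.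
  rewrite at_ bt cs ds tp subr_eq0; apply/eqP => E; apply: H.
  by exists (angle s); split; rewrite ?ex ?ey ?tp.
have N1 := near_det_neq0 ac bc cc dc n0.
have N2 : \forall s' \near s & t' \near t, a t' != 0 \/ b t' != 0.
  exact: cvg_snd ab0.
apply: filterS2 N1 N2 => -[s' t'] /= n1 ab t't [sx sy].
have E1 : c s' * (s' - s) = a t' * (t' - t) by rewrite -Xa -Xc /= sx ex.
have E2 : d s' * (s' - s) = b t' * (t' - t) by rewrite -Yb -Yd /= sy ey.
have : (a t' * d s' - b t' * c s') * (s' - s) = 0.
  by rewrite mulrBl -!mulrA E1 E2; ring.
move/eqP; rewrite mulf_eq0 (negbTE n1) /= => /eqP s0.
rewrite s0 !mulr0 in E1 E2.
have tt0 : t' - t != 0 by rewrite subr_eq0; exact/eqP.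
move/esym/eqP: E1; rewrite mulf_eq0 (negbTE tt0) orbF => /eqP a0.
move/esym/eqP: E2; rewrite mulf_eq0 (negbTE tt0) orbF => /eqP b0.
by case: ab; rewrite ?a0 ?b0 eqxx.
Unshelve. all: by end_near. Qed.

End Curves.

Section Matching.
Variable R : realType.
Implicit Types (x y dx dy : circle R -> R).

Lemma parallel_trans (a b c d e f : R) : a != 0 \/ b != 0 ->
  a * d = b * c -> a * f = b * e -> c * f = d * e.
Proof.
case=> n E1 E2; apply: (mulfI n).
  by rewrite mulrCA E2 [RHS]mulrA E1; ring.
by rewrite mulrA -E1 [RHS]mulrCA -E2; ring.
Qed.

Definition clean_curve x dx y dy : Prop :=
  [/\ C1_function x dx, C1_function y dy,
      forall p, dx p != 0 \/ dy p != 0 &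
      forall p q, x p = x q -> y p = y q -> dx p * dy q = dy p * dx q -> p = q].

Lemma matches_uniq x dx y dy x' dx' y' dy' p q r :
  clean_curve x dx y dy -> clean_curve x' dx' y' dy' ->
  matches x dx y dy x' dx' y' dy' p q -> matches x dx y dy x' dx' y' dy' p r ->
  q = r.
Proof.
move=> [_ _ imm _] [_ _ _ cl] [x1 y1 d1] [x2 y2 d2].
apply: cl; rewrite ?x1 ?x2 ?y1 ?y2 //.
exact: parallel_trans (imm p) d1 d2.
Qed.

Lemma matches_sym x dx y dy x' dx' y' dy' p q :
  matches x dx y dy x' dx' y' dy' p q -> matches x' dx' y' dy' x dx y dy q p.
Proof. by move=> [e1 e2 e3]; split=> //; rewrite mulrC -e3 mulrC. Qed.

(** Matching is a closed relation on the circle squared, and a function with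
    closed graph into a compact space is continuous. *)
Lemma matching_continuous x dx y dy x' dx' y' dy' (h : circle R -> circle R) :
  clean_curve x dx y dy -> clean_curve x' dx' y' dy' ->
  (forall p, matches x dx y dy x' dx' y' dy' p (h p)) -> continuous h.
Proof.
move=> C C' hm p U Uhp.
have [[X dX] [Y dY] _ _] := C; have [[X' dX'] [Y' dY'] _ _] := C'.
have far (f f' g g' : circle R -> R) : continuous f -> continuous f' ->
  continuous g -> continuous g' ->
    forall q, f p * f' q <> g p * g' q ->
    \forall q' \near q & p' \near p, f p' * f' q' <> g p' * g' q'.
  move=> cf cf' cg cg' q /eqP; rewrite -subr_eq0 => n0.
  have := near_det_neq0 (cf p) (cg p) (cg' q) (cf' q) n0.
  by apply: filterS => -[q' p'] /=; rewrite subr_eq0 => /eqP.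
have one : continuous (cst 1 : circle R -> R) by exact: cst_continuous.
have cx := has_derivative_continuous X; have cy := has_derivative_continuous Y.
have cx' := has_derivative_continuous X';
  have cy' := has_derivative_continuous Y'.
have cdx := continuous_circle dX; have cdy := continuous_circle dY.
have cdx' := continuous_circle dX'; have cdy' := continuous_circle dY'.
pose near_h p' q := matches x dx y dy x' dx' y' dy' p' q -> U q.
suff N : \forall p' \near p, [set: circle R] `<=` near_h p'.
  by apply: filterS N => p' /(_ (h p') I); apply; exact: hm.
have /compact_near_coveringP cov := @compact_circle R.
apply: (cov _ (nbhs p) near_h) => q _.
have [m|nm] := pselect (matches x dx y dy x' dx' y' dy' p q).
  have qh : q = h p by exact: matches_uniq C C' m (hm p).
  have : \forall q' \near q & p' \near p, U q'.
    by apply: cvg_fst; rewrite qh.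
  by apply: filterS => -[q' p'] /= Uq' _.
have [e1|n1] := pselect (x' q = x p); last first.
  have := far x (cst 1) (cst 1) x' cx one one cx' q.
  rewrite /= mulr1 mul1r => /(_ (fun E => n1 (esym E))).
  by apply: filterS => -[q' p'] /=; rewrite mulr1 mul1r => n [] /esym/n.
have [e2|n2] := pselect (y' q = y p); last first.
  have := far y (cst 1) (cst 1) y' cy one one cy' q.
  rewrite /= mulr1 mul1r => /(_ (fun E => n2 (esym E))).
  by apply: filterS => -[q' p'] /=; rewrite mulr1 mul1r => n [] _ /esym/n.
have [e3|n3] := pselect (dx p * dy' q = dy p * dx' q); first by case: nm.
by apply: filterS (far _ _ _ _ cdx cdy' cdy cdx' q n3) => -[q' p'] /= n [].
Qed.

(** A continuous solution of [G (eta s) = F s] is differentiable where [G] has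
    nonzero derivative: divide the slope of [F] by that of [G]. *)
Lemma implicit_derive (G eta F : R -> R) (t d c : R) :
  is_derive (eta t) 1 G d -> d != 0 -> is_derive t 1 F c ->
  {for t, continuous eta} -> (\forall s \near t, G (eta s) = F s) ->
  is_derive t 1 eta (c / d).
Proof.
move=> /is_derive1_caratheodory[g [Gg gc gd]] d0.
move=> /is_derive1_caratheodory[phi [Fphi phic phit]] ec GF.
apply/is_derive1_caratheodory.
pose k s := if s == t then c / d else (eta s - eta t) / (s - t).
have kt : k t = c / d by rewrite /k eqxx.
exists k; split=> //.
  move=> s; rewrite /k; case: eqVneq => [->|st]; first by rewrite !subrr mulr0.
  by rewrite divfK // subr_eq0.
have ge : {for t, continuous (g \o eta)} by apply: continuous_comp.
have Gt : G (eta t) = F t by exact: nbhs_singleton GF.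
have gn : \forall s \near t, g (eta s) != 0.
  by apply: near_neq ge _; rewrite /= gd.
rewrite /prop_for /continuous_at kt.
have L : phi s / g (eta s) @[s --> t] --> (c / d : R).
  have gL : (g (eta s))^-1 @[s --> t] --> d^-1.
    by apply: cvgV => //; rewrite -gd; exact: ge.
  by apply: cvgM gL; rewrite -phit; exact: phic.
apply: cvg_trans L; apply: near_eq_cvg; near=> s.
have gs : g (eta s) != 0 by near: s.
have Gs : G (eta s) = F s by near: s.
rewrite /k; case: eqVneq => [->|st]; first by rewrite phit gd.
have st0 : s - t != 0 by rewrite subr_eq0.
apply: (mulIf gs); apply: (mulIf st0).
by rewrite divfK // -Fphi -Gs -Gt Gg; field.
Unshelve. all: by end_near. Qed.

End Matching.

Section CircleMaps.
Variable R : realType.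
Implicit Types (x y dx dy : circle R -> R).

Lemma angleD (s t h : R) : angle s = angle t -> angle (h + s) = angle (h + t).
Proof.
move=> /(congr1 val)/= /rowP E; have := E 0; have := E 1;
  rewrite !mxE /= => es ec.
by apply/val_inj/row2P; rewrite !mxE /= ?cosD ?sinD es ec.
Qed.

Lemma differential_angle (F : circle R -> 'rV[R]_2) (s t : R) :
  angle s = angle t -> differential F s = differential F t.
Proof.
move=> E; rewrite /differential /derive1 /circle_lift /= E.
suff -> : (fun h => h^-1 *: (F (angle (h + s)) - F (angle t))) =
  (fun h => h^-1 *: (F (angle (h + t)) - F (angle t))) by [].
by apply/funext => h; rewrite (angleD h E).
Qed.

(** The differential at an angle depends only on the point of the circle, so any
    choice of the angle will do. *)
Definition velocity (F : circle R -> 'rV[R]_2) (p : circle R) : 'rV[R]_2 :=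
  differential F (sval (cid2 (angle_lift 0 p))).

Lemma velocityE (F : circle R -> 'rV[R]_2) (t : R) :
  velocity F (angle t) = differential F t.
Proof. by apply: differential_angle; case: cid2. Qed.

Lemma C1_coord (F : circle R -> 'rV[R]_2) (j : 'I_2) : C1 F ->
  C1_function (fun p => F p 0 j) (fun p => velocity F p 0 j).
Proof.
move=> [dF cF]; split.
  move=> t; have /derivable_mxP/(_ 0 j) dj := dF t.
  apply: DeriveDef; first exact: dj.
  by rewrite velocityE /differential derive1E derive_mx ?mxE.
have -> : (fun p => velocity F p 0 j) \o @angle R =
    (fun M : 'rV[R]_2 => M 0 j) \o derive1 (circle_lift F).
  by apply/funext => s; rewrite /= velocityE.
by move=> t; apply: continuous_comp; [exact: cF|exact: coord_continuous].
Qed.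

Lemma C1_of_coords (F : circle R -> 'rV[R]_2) du dv :
  C1_function (fun p => F p 0 0) du -> C1_function (fun p => F p 0 1) dv -> C1
    F.
Proof.
move=> [du_ cu] [dv_ cv].
have dF t : derivable (circle_lift F) t 1.
  apply/derivable_mxP => i j; rewrite ord1.
  case: j => -[|[|//]] j2.
    by rewrite (_ : Ordinal j2 = 0); [have [] := du_ t|exact: val_inj].
  by rewrite (_ : Ordinal j2 = 1); [have [] := dv_ t|exact: val_inj].
split; first exact: dF.
have -> : derive1 (circle_lift F) =
    (fun t => du (angle t) *: delta_mx 0 0 + dv (angle t) *: delta_mx 0 1).
  apply/funext => t; rewrite derive1E derive_mx; last exact: dF.
  have [_ e0] := du_ t; have [_ e1] := dv_ t.
  apply/row2P; rewrite !mxE /= ?mulr0 ?mulr1 ?addr0 ?add0r.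
    exact: e0.
  exact: e1.
by move=> t; apply: cvgD; apply: cvgZr_tmp; [exact: cu|exact: cv].
Qed.

(** Angles relative to a base direction are given by the arc sine on the open
    half circle around it. *)
Lemma local_angle (q : R -> circle R) (t : R) : continuous q ->
  exists2 eta : R -> R, {for t, continuous eta} &
    \forall s \near t, angle (eta s) = q s.
Proof.
move=> cq; have [th _ thq] := angle_lift 0 (q t).
pose c s := cos th * \val (q s) 0 0 + sin th * \val (q s) 0 1.
pose w s := cos th * \val (q s) 0 1 - sin th * \val (q s) 0 0.
have cco j : continuous (fun s => \val (q s) 0 j).
  move=> s; apply: (@continuous_comp _ _ _ q (fun p : circle R => \val p 0 j)).
    exact: cq.
  apply: (@continuous_comp _ _ _ (fun p : circle R => \val p)
    (fun M : 'rV[R]_2 => M 0 j)); first exact: continuous_circle_val.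
  exact: coord_continuous.
have cmul (a : R) j : continuous (fun s => a * \val (q s) 0 j).
  by move=> s; apply: cvgM; [exact: cvg_cst|exact: cco].
have cc : continuous c by move=> s; apply: cvgD; exact: cmul.
have cw : continuous w by move=> s; apply: cvgB; exact: cmul.
have qt : \val (q t) = cos_sin th by rewrite -thq.
have ct : c t = 1 by rewrite /c qt !mxE /= -!expr2 cos2Dsin2.
have wt : w t = 0 by rewrite /w qt !mxE /= mulrC subrr.
have cw1 s : c s ^+ 2 + w s ^+ 2 = 1.
  have qs : \val (q s) 0 0 ^+ 2 + \val (q s) 0 1 ^+ 2 = 1 by have := set_valP
    (q s).
  by rewrite -[RHS](mulr1 1) -{1}(cos2Dsin2 th) -qs /c /w; ring.
have c_gt0 : \forall s \near t, 0 < c s.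
  by have := cc t; rewrite /continuous_at ct => /cvgr_gt/(_ _ ltr01).
exists (fun s => th + asin (w s)).
  apply: cvgD; first exact: cvg_cst.
  apply: (@continuous_comp _ _ _ w (@asin R)); first exact: cw.
  by apply: continuous_asin; rewrite wt ltrN10 ltr01.
apply: filterS c_gt0 => s c0.
have w1 : -1 <= w s <= 1 by move: (c s) (w s) (cw1 s) => u v ?; apply/andP;
  split; nra.
have cE : Num.sqrt (1 - w s ^+ 2) = c s.
  by rewrite -(cw1 s) addrK sqrtr_sqr gtr0_norm.
have sE : sin (asin (w s)) = w s by apply: asinK; rewrite in_itv.
have t1 := cos2Dsin2 th.
apply/val_inj/row2P; rewrite !mxE /= ?cosD ?sinD sE cos_asin // cE /c /w.
  by rewrite -[RHS]mul1r -t1; ring.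
by rewrite -[RHS]mul1r -t1; ring.
Qed.

Lemma speed_eq (a b c d : R) : c ^+ 2 + d ^+ 2 != 0 -> c != 0 ->
  a * d = b * c -> a / c = (a * c + b * d) / (c ^+ 2 + d ^+ 2).
Proof.
move=> n0 c0 E; apply/eqP; rewrite eqr_div //; apply/eqP.
have -> : a * (c ^+ 2 + d ^+ 2) = a * c ^+ 2 + a * d * d by ring.
by rewrite E; ring.
Qed.

(** Locally [h] is given by an angle [eta] which, by [implicit_derive] for one
    of the coordinates, has as derivative the ratio of the two velocities. As
    these are parallel, this is the quotient of their scalar product by the
    squared norm of the second, a formula that is continuous all around the
    circle. *)
Lemma matching_C1 x dx y dy x' dx' y' dy' (h : circle R -> circle R) :
  clean_curve x dx y dy -> clean_curve x' dx' y' dy' ->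
  (forall p, matches x dx y dy x' dx' y' dy' p (h p)) -> C1_circle h.
Proof.
move=> C C' hm; have ch := matching_continuous C C' hm.
have [[X cX] [Y cY] _ _] := C; have [[X' cX'] [Y' cY'] imm' _] := C'.
pose nrm p := dx' p ^+ 2 + dy' p ^+ 2.
have nrm0 p : nrm p != 0.
  by rewrite paddr_eq0 ?sqr_ge0 // !sqrf_eq0 negb_and; apply/orP; exact: imm'.
pose speed p := (dx p * dx' (h p) + dy p * dy' (h p)) / nrm (h p).
have chd (f : circle R -> R) :
    continuous (f \o @angle R) -> continuous ((f \o h) \o @angle R).
  move=> cf; have {}cf := continuous_circle cf.
  move=> t; apply: (@continuous_comp _ _ _ (@angle R) (f \o h)).
    exact: continuous_angle.
  by apply: (@continuous_comp _ _ _ h f); [exact: ch|exact: cf].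
have cspeed : continuous (speed \o @angle R).
  have cx' := chd _ cX'; have cy' := chd _ cY'.
  move=> t; apply: cvgM.
    by apply: cvgD; apply: cvgM; [exact: cX|exact: cx'|exact: cY|exact: cy'].
  apply: cvgV; first exact: nrm0.
  by apply: cvgD; apply: cvgM; [exact: cx'|exact: cx'|exact: cy'|exact: cy'].
have lift (t : R) : exists eta : R -> R, [/\ is_derive t 1 eta (speed (angle
  t)),
    angle (eta t) = h (angle t) & \forall s \near t, angle (eta s) = h (angle
      s)].
  have cq : continuous (h \o @angle R).
    by move=> s; apply: continuous_comp; [exact: continuous_angle|exact: ch].
  have [eta ce le] := local_angle t cq.
  have et : angle (eta t) = h (angle t) by exact: nbhs_singleton le.
  exists eta; split=> //; have [_ _ par] := hm (angle t).
  have := imm' (h (angle t)).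
  have imp (f df f' df' : circle R -> R) : has_derivative f df ->
    has_derivative f' df' ->
      (forall p, f' (h p) = f p) -> df' (h (angle t)) != 0 ->
      is_derive t 1 eta (df (angle t) / df' (h (angle t))).
    move=> df_ df'_ E n; apply: (implicit_derive _ n (df_ t) ce).
      by rewrite -et; exact: df'_.
    by apply: filterS le => s /= ->.
  case=> n.
    apply: is_derive_eq (imp _ _ _ _ X X' (fun p => let: And3 e _ _ := hm p in
      e) n) _.
    exact: speed_eq (nrm0 _) n par.
  apply: is_derive_eq (imp _ _ _ _ Y Y' (fun p => let: And3 _ e _ := hm p in e)
    n) _.
  rewrite (speed_eq _ n (esym par)); last by rewrite addrC; exact: nrm0.
  by rewrite /speed /nrm addrC [dy' _ ^+ 2 + _]addrC.
pose dh0 p := - speed p * \val (h p) 0 1.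
pose dh1 p := speed p * \val (h p) 0 0.
have ccoord j : continuous ((fun p => \val (h p) 0 j) \o @angle R).
  apply: (chd (fun p : circle R => \val p 0 j)) => t.
  apply: (@continuous_comp _ _ _ (@cos_sin R) (fun M : 'rV[R]_2 => M 0 j)).
    exact: continuous_cos_sin.
  exact: coord_continuous.
apply: (@C1_of_coords _ dh0 dh1); split.
- move=> t; have [eta [de et le]] := lift t.
  have : is_derive t 1 (@cos R \o eta) (dh0 (angle t)).
    apply: is_derive_eq (is_derive1_comp (is_derive_cos (eta t)) de) _.
    by rewrite /dh0 -et !mxE /= mulNr mulrC mulNr.
  by apply: near_eq_is_derive; apply: filterS le => s /= <-; rewrite !mxE.
- move=> t; apply: cvgM; last exact: ccoord.
  by apply: cvgN; exact: cspeed.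
- move=> t; have [eta [de et le]] := lift t.
  have : is_derive t 1 (@sin R \o eta) (dh1 (angle t)).
    apply: is_derive_eq (is_derive1_comp (is_derive_sin (eta t)) de) _.
    by rewrite /dh1 -et !mxE /= mulrC.
  by apply: near_eq_is_derive; apply: filterS le => s /= <-; rewrite !mxE.
- by move=> t; apply: cvgM; [exact: cspeed|exact: ccoord].
Qed.

End CircleMaps.

(** * Generic curves *)

Section Generic.
Variable R : realType.

Lemma submx_row2 (A B : 'rV[R]_2) : B 0 0 != 0 \/ B 0 1 != 0 ->
  A 0 0 * B 0 1 = A 0 1 * B 0 0 -> (A <= B)%MS.
Proof.
case=> n E.
  rewrite (_ : A = (A 0 0 / B 0 0) *: B) ?scalemx_sub //.
  apply/row2P; rewrite !mxE; first by rewrite divfK.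
  by rewrite mulrAC E mulfK.
rewrite (_ : A = (A 0 1 / B 0 1) *: B) ?scalemx_sub //.
apply/row2P; rewrite !mxE; last by rewrite divfK.
by rewrite mulrAC -E mulfK.
Qed.

Lemma generic_clean_curve (f : circle R -> 'rV[R]_2) : generic f ->
  clean_curve (fun p => f p 0 0) (fun p => velocity f p 0 0)
              (fun p => f p 0 1) (fun p => velocity f p 0 1).
Proof.
move=> [fC1 fimm _ _ fclean].
have imm p : velocity f p 0 0 != 0 \/ velocity f p 0 1 != 0.
  have [t _ <-] := angle_lift 0 p; rewrite velocityE.
  apply/orP; rewrite -negb_and; apply/negP => /andP[/eqP d0 /eqP d1].
  have := fimm t; rewrite (_ : differential f t = 0) ?mxrank0 //.
  by apply/row2P; rewrite ?d0 ?d1 mxE.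
split=> //; [exact: C1_coord|exact: C1_coord|].
move=> p q fx fy par; have [t _ tp] := angle_lift 0 p.
have [s _ sq] := angle_lift 0 q.
rewrite -tp -sq; apply: fclean; first by rewrite tp sq; exact: row2P.
rewrite -!velocityE tp sq; apply/andP; split; apply: submx_row2 => //.
by rewrite mulrC -par mulrC.
Qed.

Lemma same_ranks_of_persistence (f g : circle R -> 'rV[R]_2) :
  (forall u v : 'rV[R]_2, Delta_plus (u, v) ->
     forall s : 'rV[R]_2 -> 'rV[R]_2, Sigma2 s ->
     persistent_H0_isomorphic (s \o f) (s \o g) u v) ->
  same_ranks (fun p => f p 0 0) (fun p => f p 0 1)
             (fun p => g p 0 0) (fun p => g p 0 1).
Proof.
move=> H.
pose row2 (a b : R) : 'rV[R]_2 := \row_(i < 2) if i == 0 then a else b.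
have pre (F : circle R -> 'rV[R]_2) phi psi a b :
    (forall p, F p 0 0 = phi p) -> (forall p, F p 0 1 = psi p) ->
    F @^-1` lower_quadrant (row2 a b) = sublevel phi psi a b.
  move=> E0 E1; apply/seteqP; split=> p;
    by rewrite /lower_quadrant /sublevel /= !mxE /= E0 E1.
have key s phi psi phi' psi' : Sigma2 s ->
    (forall p, s (f p) 0 0 = phi p) -> (forall p, s (f p) 0 1 = psi p) ->
    (forall p, s (g p) 0 0 = phi' p) -> (forall p, s (g p) 0 1 = psi' p) ->
    same_rank phi psi phi' psi'.
  move=> Ss f0 f1 g0 g1 a b a' b' aa' bb' k.
  have := H (row2 a b) (row2 a' b') _ s Ss k.
  rewrite /persistent_H0_rank !(pre (s \o f) phi psi) // !(pre (s \o g) phi'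
    psi') //.
  by apply; split; rewrite /= !mxE.
split.
- by apply: (key id) => //; constructor 1.
- by apply: (key (@reflection1 R)) => [|p|p|p|p]; rewrite ?mxE //=;
  constructor 2.
- by apply: (key (@reflection2 R)) => [|p|p|p|p]; rewrite ?mxE //=;
  constructor 3.
Qed.

Lemma matching_exists (f g : circle R -> 'rV[R]_2) : generic f -> generic g ->
  same_ranks (fun p => f p 0 0) (fun p => f p 0 1)
             (fun p => g p 0 0) (fun p => g p 0 1) ->
  forall p, exists q,
    matches (fun p => f p 0 0) (fun p => velocity f p 0 0)
            (fun p => f p 0 1) (fun p => velocity f p 0 1)
            (fun p => g p 0 0) (fun p => velocity g p 0 0)
            (fun p => g p 0 1) (fun p => velocity g p 0 1) p q.
Proof.
move=> /generic_clean_curve[X Y imm _] /generic_clean_curve[X' Y' _ _] S.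
exact: tangent_exists X.1 Y.1 X'.1 Y'.1 imm (planar_image_sub S X Y X' Y' imm).
Qed.

End Generic.

Theorem theorem4p1 (R : realType) (f g : circle R -> 'rV[R]_2)
    (hf : generic f) (hg : generic g)
    (hH0 : forall u v : 'rV[R]_2, Delta_plus (u, v) ->
       forall s : 'rV[R]_2 -> 'rV[R]_2, Sigma2 s ->
       persistent_H0_isomorphic (s \o f) (s \o g) u v) :
  exists h : circle R -> circle R, C1_diffeomorphism h /\ g \o h = f.
Proof.
have S := same_ranks_of_persistence hH0.
have /choice[h hm] := matching_exists hf hg S.
have /choice[k km] := matching_exists hg hf (same_ranks_sym S).
have Cf := generic_clean_curve hf; have Cg := generic_clean_curve hg.
exists h; split; last first.
  by apply/funext => p; have [e0 e1 _] := hm p; exact: row2P.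
exists k; split; [| |exact: matching_C1 Cf Cg hm|exact: matching_C1 Cg Cf km].
  by move=> p; apply: (matches_uniq Cg Cf (km (h p))); exact/matches_sym/hm.
by move=> q; apply: (matches_uniq Cf Cg (hm (k q))); exact/matches_sym/km.
Qed.
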